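(* Let $G=1+\mathcal{A}$ be a countable discrete algebra group associated with a nil $\Bbbk$-algebra $\mathcal{A}$, and let $\Gamma=G\times G$. For every $\xi\in\mathrm{SCh}(G)$ there is a unique measure $\mu^{\xi}\in\mathcal{M}^{+}_{\Gamma}(\mathcal{A}^{\circ})$ such that $\xi(g)=\int_{\mathcal{A}^{\circ}}\vartheta(g-1)\,d\mu^{\xi}(\vartheta)$ for all $g\in G$, and the mapping $\xi\mapsto\mu^{\xi}$ defines an affine homeomorphism between $\mathrm{SCh}(G)$ and $\mathcal{M}^{+}_{\Gamma}(\mathcal{A}^{\circ})$, with inverse given by $\mu\mapsto\xi^{\mu}$, where $\xi^{\mu}(g)=\int_{\mathcal{A}^{\circ}}\vartheta(g-1)\,d\mu(\vartheta)$ for all $g\in G$. In particular, the indecomposable supercharacters of $G$ are in one-to-one correspondence (via $\xi\mapsto\mu^\xi$) with the ergodic measures in $\mathcal{M}_{\Gamma}^{+}(\mathcal{A}^{\circ})$.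
   Context: Let $\Bbbk$ be a countable discrete field and $\mathcal{A}$ a countable associative nil $\Bbbk$-algebra (every element is nilpotent; $\mathcal{A}$ need not be finite-dimensional). The algebra group $G=1+\mathcal{A}$ is the set of formal objects $1+a$ ($a\in\mathcal{A}$) with multiplication $(1+a)(1+b)=1+a+b+ab$, equipped with the discrete topology. The group $\Gamma=G\times G$ acts on $\mathcal{A}$ by $(g,h)\cdot a=gah^{-1}$. $\mathcal{A}^{\circ}$ is the Pontryagin dual of the additive group of $\mathcal{A}$ (all unitary characters), with the topology of pointwise convergence (a compact abelian group); $\Gamma$ acts on $\mathcal{A}^{\circ}$ by $((g,h)\cdot\vartheta)(a)=\vartheta(g^{-1}ah)$. A superclass of $G$ is a set $1+GaG$ with $a\in\mathcal{A}$. A function $\varphi\colon G\to\mathbb{C}$ is positive definite if $\varphi(g^{-1})=\overline{\varphi(g)}$ for all $g\in G$ and every matrix $[\varphi(g_ig_j^{-1})]_{i,j}$ ($g_1,\dots,g_m\in G$) is nonnegative. $\mathrm{SCh}(G)$ is the convex set of supercharacters of $G$, i.e. positive definite functions $\varphi\colon G\to\mathbb{C}$ with $\varphi(1)=1$ that are constant on superclasses, with the topology of pointwise convergence; its extreme points are the indecomposable supercharacters. $\mathcal{M}^{+}_{\Gamma}(\mathcal{A}^{\circ})$ is the set of $\Gamma$-invariant regular Borel probability measures on $\mathcal{A}^{\circ}$, with the weak*-topology. Such a $\mu$ is ergodic if $\mu(B)\in\{0,1\}$ for every $\Gamma$-invariant Borel set $B\subseteq\mathcal{A}^\circ$. *)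

(* Defs.v *)
From HB Require Import structures.
From mathcomp Require Import all_boot all_order all_algebra.
From mathcomp Require Import complex.
From mathcomp Require Import all_classical all_reals all_analysis.

Set Implicit Arguments.
Unset Strict Implicit.
Unset Printing Implicit Defensive.

Import Order.TTheory GRing.Theory Num.Theory.
Import numFieldNormedType.Exports.

Local Open Scope classical_set_scope.
Local Open Scope ring_scope.

(* Associative algebras without unit (a nonzero nil algebra has none). *)
HB.mixin Record isAssocAlgebra (k : fieldType) A & GRing.Lmodule k A := {
  amul : A -> A -> A;
  amulA : associative amul;
  amulDl : forall a b c : A, amul (a + b) c = amul a c + amul b c;
  amulDr : forall a b c : A, amul a (b + c) = amul a b + amul a c;
  amulZl : forall (x : k) (a b : A), amul (x *: a) b = x *: amul a b;
  amulZr : forall (x : k) (a b : A), amul a (x *: b) = x *: amul a b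
}.

#[short(type="assocAlgType")]
HB.structure Definition AssocAlgebra (k : fieldType) :=
  {A of isAssocAlgebra k A & GRing.Lmodule k A}.

(* [apow a n] is a ^ (n + 1): there is no a ^ 0 without a unit. *)
Definition apow (k : fieldType) (A : assocAlgType k) (a : A) (n : nat) : A :=
  iter n (amul a) a.

HB.mixin Record isNil (k : fieldType) A & AssocAlgebra k A := {
  nilpotentA : forall a : A, exists n, apow a n = 0
}.

#[short(type="nilAlgType")]
HB.structure Definition NilAlgebra (k : fieldType) :=
  {A of isNil k A & AssocAlgebra k A}.

Section AssocAlgebraTheory.
Variables (k : fieldType) (A : assocAlgType k).
Implicit Types a b : A.

Lemma amulNl a b : amul (- a) b = - amul a b.
Proof. by rewrite -scaleN1r amulZl scaleN1r. Qed.

Lemma amulNr a b : amul a (- b) = - amul a b.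
Proof. by rewrite -scaleN1r amulZr scaleN1r. Qed.

Lemma amul0l a : amul 0 a = 0.
Proof. by have := amulZl 0 (0 : A) a; rewrite !scale0r. Qed.

Lemma amul0r a : amul a 0 = 0.
Proof. by have := amulZr 0 a (0 : A); rewrite !scale0r. Qed.

Lemma amul_sumr a n (F : nat -> A) :
  amul a (\sum_(0 <= i < n) F i) = \sum_(0 <= i < n) amul a (F i).
Proof. exact: (big_morph _ (amulDr a) (amul0r a)). Qed.

Lemma amul_suml a n (F : nat -> A) :
  amul (\sum_(0 <= i < n) F i) a = \sum_(0 <= i < n) amul (F i) a.
Proof.
exact: (big_morph (amul ^~ a) (fun x y => amulDl x y a) (amul0l a)).
Qed.

Lemma apow_comm a n : amul a (apow a n) = amul (apow a n) a.
Proof. by elim: n => //= n IH; rewrite {1}IH amulA. Qed.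

End AssocAlgebraTheory.

Section AlgebraGroup.
Variables (k : fieldType) (A : nilAlgType k).

Lemma quasi_inverse_exists (a : A) :
  exists b : A, a + b + amul a b = 0 /\ b + a + amul b a = 0.
Proof.
have [n an0] := nilpotentA (- a).
pose b := \sum_(0 <= i < n) apow (- a) i.
have shift : \sum_(0 <= i < n) apow (- a) i.+1 = b - (- a).
  have := congr1 id (erefl (\sum_(0 <= i < n.+1) apow (- a) i)).
  rewrite {1}big_nat_recl// big_nat_recr//= -/b an0 addr0 => <-.
  by rewrite /= addrAC subrr add0r.
have cb : amul (- a) b = b - - a.
  by rewrite amul_sumr -shift; apply: eq_bigr.
have bc : amul b (- a) = b - - a.
  by rewrite amul_suml -shift; apply: eq_bigr => i _; rewrite -apow_comm.
exists b; split.
- by rewrite -[amul a b]opprK -amulNl cb opprK [b + a]addrC subrr.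
- by rewrite -[amul b a]opprK -amulNr bc opprK subrr.
Qed.

Definition quasi_inverse (a : A) : A := projT1 (cid (quasi_inverse_exists a)).

Lemma quasi_inverser (a : A) : a + quasi_inverse a + amul a (quasi_inverse a) = 0.
Proof. by rewrite /quasi_inverse; case: cid => b []. Qed.

Lemma quasi_inversel (a : A) : quasi_inverse a + a + amul (quasi_inverse a) a = 0.
Proof. by rewrite /quasi_inverse; case: cid => b []. Qed.

(* [OnePlus a] is the formal object 1 + a, and [subone g] is g - 1. *)
Record algebra_group := OnePlus { subone : A }.

HB.instance Definition _ := [isNew for subone].
HB.instance Definition _ := [Choice of algebra_group by <:].

Definition ag_mul (g h : algebra_group) : algebra_group :=
  OnePlus (subone g + subone h + amul (subone g) (subone h)).

Definition ag_inv (g : algebra_group) : algebra_group :=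
  OnePlus (quasi_inverse (subone g)).

Lemma ag_mulA : associative ag_mul.
Proof.
move=> [a] [b] [c]; congr OnePlus => /=.
rewrite !amulDr !amulDl amulA !addrA; congr (_ + _).
rewrite -!addrA; do 2 congr (_ + _).
by rewrite [amul b c + _]addrCA [LHS]addrCA [amul b c + _]addrC.
Qed.

Lemma ag_mul1g : left_id (OnePlus 0) ag_mul.
Proof. by move=> [a]; congr OnePlus => /=; rewrite amul0l add0r addr0. Qed.

Lemma ag_mulg1 : right_id (OnePlus 0) ag_mul.
Proof. by move=> [a]; congr OnePlus => /=; rewrite amul0r !addr0. Qed.

Lemma ag_mulVg : left_inverse (OnePlus 0) ag_inv ag_mul.
Proof. by move=> [a]; congr OnePlus => /=; rewrite quasi_inversel. Qed.

Lemma ag_mulgV : right_inverse (OnePlus 0) ag_inv ag_mul.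
Proof. by move=> [a]; congr OnePlus => /=; rewrite quasi_inverser. Qed.

HB.instance Definition _ := isGroup.Build algebra_group
  ag_mulA ag_mul1g ag_mulg1 ag_mulVg ag_mulgV.

(* g a h, with g = 1 + x and h = 1 + y expanded. *)
Definition bimul (g : algebra_group) (a : A) (h : algebra_group) : A :=
  let ga := a + amul (subone g) a in ga + amul ga (subone h).

Lemma bimulD g a b h : bimul g (a + b) h = bimul g a h + bimul g b h.
Proof. by rewrite /bimul /= amulDr addrACA amulDl [LHS]addrACA. Qed.

Definition superclass (a : A) : set algebra_group :=
  [set x | exists g h, subone x = bimul g a h].

End AlgebraGroup.

Section Supercharacters.
Variables (R : realType) (k : fieldType) (A : nilAlgType k).

Definition nonneg_mx (m : nat) (M : 'M[R[i]]_m) : Prop :=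
  forall v : 'cV[R[i]]_m, 0 <= ((map_mx Num.conj v)^T *m M *m v) 0 0.

Definition positive_definite (G : groupType) (phi : G -> R[i]) : Prop :=
  (forall g : G, phi (g^-1)%g = Num.conj (phi g)) /\
  (forall (m : nat) (g : 'I_m -> G),
     nonneg_mx (\matrix_(i, j) phi (g i * (g j)^-1)%g)).

(* R[i]^o is R[i] with the topology of its norm. *)
Definition SCh_set : set {ptws algebra_group A -> R[i]^o} :=
  [set phi | [/\ positive_definite phi, phi 1%g = 1 &
     forall (a : A) x y, superclass a x -> superclass a y -> phi x = phi y]].

Definition SCh : Type := SCh_set.
HB.instance Definition _ := Topological.on SCh.

Definition SCh_fun (xi : SCh) : algebra_group A -> R[i] := set_val xi.
Coercion SCh_fun : SCh >-> Funclass.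

Definition conv_fun (t : {i01 R}) (phi psi : algebra_group A -> R[i]) :
    {ptws algebra_group A -> R[i]^o} :=
  fun g => (t%:num)%:C%C * phi g + (1 - t%:num)%:C%C * psi g.

Lemma SCh_convex (t : {i01 R}) (xi eta : SCh) :
  SCh_set (conv_fun t xi eta).
Proof.
have [[xiV xi_psd] xi1 xiC] : SCh_set xi := set_valP xi.
have [[etaV eta_psd] eta1 etaC] : SCh_set eta := set_valP eta.
have t0 : 0 <= (t%:num)%:C%C :> R[i] by rewrite lecR ge0.
have t1 : 0 <= (1 - t%:num)%:C%C :> R[i] by rewrite lecR subr_ge0 le1.
split; first split.
- move=> g; rewrite /conv_fun xiV etaV.
  rewrite [RHS]rmorphD [X in _ = X + _]rmorphM [X in _ = _ + X]rmorphM.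
  by congr (_ * _ + _ * _); apply/esym/CrealP/ger0_real.
- move=> m g v; set M := \matrix_(i, j) _.
  have -> : M = (t%:num)%:C%C *: (\matrix_(i, j) xi (g i * (g j)^-1)%g)
      + (1 - t%:num)%:C%C *: (\matrix_(i, j) eta (g i * (g j)^-1)%g).
    by apply/matrixP => i j; rewrite !mxE.
  rewrite mulmxDr mulmxDl -!scalemxAr -!scalemxAl.
  rewrite mxE [X in _ <= X + _]mxE [X in _ <= _ + X]mxE.
  by rewrite addr_ge0// mulr_ge0//; [exact: xi_psd|exact: eta_psd].
- by rewrite /conv_fun xi1 eta1 !mulr1 -rmorphD /= addrC subrK.
- move=> a x y ax ay; rewrite /conv_fun.
  by rewrite (xiC _ _ _ ax ay) (etaC _ _ _ ax ay).
Qed.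

Definition SCh_conv (t : {i01 R}) (xi eta : SCh) : SCh :=
  exist _ (conv_fun t xi eta)
    (mem_set (SCh_convex t xi eta)).

Definition indecomposable (xi : SCh) : Prop :=
  forall (t : {i01 R}) (xi1 xi2 : SCh), 0 < t%:num < 1 ->
    xi = SCh_conv t xi1 xi2 -> xi1 = xi /\ xi2 = xi.

End Supercharacters.

Section Dual.
Variables (R : realType) (k : fieldType) (A : nilAlgType k).

Definition character_set : set {ptws A -> R[i]^o} :=
  [set th : A -> R[i] | (forall a b, th (a + b) = th a * th b) /\
                 (forall a, `|th a| = 1)].

Definition dual : Type := character_set.
HB.instance Definition _ := Topological.on dual.

Definition dual_fun (th : dual) : A -> R[i] := set_val th.
Coercion dual_fun : dual >-> Funclass.

Lemma trivial_character : character_set (fun=> 1).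
Proof. by split=> [a b|a]; rewrite ?mulr1 ?normr1. Qed.

Definition trivial_dual : dual := 
  exist _ (fun=> 1) (mem_set trivial_character).

HB.instance Definition _ := isPointed.Build dual trivial_dual.

Lemma dual_act_subproof (g h : algebra_group A) (th : dual) :
  character_set (fun a => th (bimul g^-1 a h)%g).
Proof.
case: (set_valP th) => thD th1; split=> [a b|a]; last exact: th1.
by rewrite bimulD; exact: thD.
Qed.

Definition dual_act (gam : algebra_group A * algebra_group A) (th : dual) :
    dual :=
  exist _ (fun a => th (bimul gam.1^-1 a gam.2)%g)
    (mem_set (dual_act_subproof gam.1 gam.2 th)).

Definition borel_dual := g_sigma_algebraType (@open dual).

Definition regular_measure (mu : set borel_dual -> \bar R) : Prop :=
  forall B : set borel_dual, measurable B ->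
    mu B = ereal_inf [set mu U | U in [set U | @open dual U /\ B `<=` U]] /\
    mu B = ereal_sup [set mu K | K in [set K | @compact dual K /\ K `<=` B]].

Definition invariant_measure (mu : set borel_dual -> \bar R) : Prop :=
  forall gam (B : set borel_dual), measurable B ->
    mu (dual_act gam @^-1` B) = mu B.

(* A measure of MathComp-Analysis is a function on all subsets, whose values
   outside the sigma-algebra carry no meaning. They are set to 0 here, so that
   equality in [inv_measure] is equality of measures. *)
Definition null_off_borel (mu : set borel_dual -> \bar R) : Prop :=
  forall B : set borel_dual, ~ measurable B -> mu B = 0%E.

Definition inv_measure_set : set (probability borel_dual R) :=
  [set mu | [/\ regular_measure mu, invariant_measure mu & null_off_borel mu]].

Definition inv_measure : Type := inv_measure_set.

Definition measure_of (mu : inv_measure) : probability borel_dual R :=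
  set_val mu.

Definition cintegral (mu : inv_measure) (f : dual -> R[i]) : R[i] :=
  ((\int[measure_of mu]_th complex.Re (f th)) +i*
   (\int[measure_of mu]_th complex.Im (f th)))%C.

(* As the dual is compact, its continuous functions are bounded, and the
   weak* topology is that of pointwise convergence on them. *)
Definition weak_star_eval (mu : inv_measure) : 
    {ptws continuousType dual R[i]^o -> R[i]^o} :=
  fun f => cintegral mu f.

HB.instance Definition _ := Choice.on inv_measure.
HB.instance Definition _ :=
  Topological.copy inv_measure (initial_topology weak_star_eval).

Definition ergodic (mu : inv_measure) : Prop :=
  forall B : set borel_dual, measurable B ->
    (forall gam, dual_act gam @` B = B) ->
    measure_of mu B = 0%E \/ measure_of mu B = 1%E.

End Dual.

Section Correspondence.
Variables (R : realType) (k : fieldType) (A : nilAlgType k).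

Definition affine (M : SCh R A -> inv_measure R A) : Prop :=
  forall (t : {i01 R}) (xi eta : SCh R A) (B : set (borel_dual R A)),
    measurable B ->
    measure_of (M (SCh_conv t xi eta)) B =
    ((t%:num)%:E * measure_of (M xi) B +
     (1 - t%:num)%:E * measure_of (M eta) B)%E.

End Correspondence.

Definition homeomorphism (X Y : topologicalType) (f : X -> Y) (g : Y -> X) :
    Prop :=
  [/\ cancel f g, cancel g f, continuous f & continuous g].

(* Main.v *)
Require Import Defs.
From HB Require Import structures.
From mathcomp Require Import all_boot all_order all_algebra.
From mathcomp Require Import complex.
From mathcomp Require Import all_classical all_reals all_analysis.
From mathcomp Require Import measurable_realfun ring lra zify finmap.
From mathcomp Require cyclic separable cyclotomic.

Set Implicit Arguments.
Unset Strict Implicit.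
Unset Printing Implicit Defensive.

Import Order.TTheory GRing.Theory Num.Theory.
Import numFieldNormedType.Exports.

Local Open Scope classical_set_scope.
Local Open Scope ring_scope.

(** Since gh^-1 - 1 = (g - h) h^-1 lies in the superclass of g - h, a function
xi constant on superclasses is positive definite on G exactly when
a |-> xi (1 + a) is positive definite on the additive group of A, and it is then
invariant under a |-> g a h. Bochner's theorem on the compact dual of A
turns xi into a probability; uniqueness of Fourier coefficients turns the
invariance of xi into the invariance of the measure.

Bochner's theorem: finite positive measures on the torus with almost the right
low order moments are written down, and an ultrafilter limit of the
corresponding means is represented by a regular measure (a Riesz theorem for
positive normalized functionals on bounded Borel functions). Its third order
moments force it onto the characters. The same representation applied to an
ultrafilter limit of the measures of supercharacters converging to xi gives
continuity.

Ergodicity: if mu = t mu1 + (1-t) mu2 is ergodic, the union of the translates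
of a negative set of mu1 - mu is invariant, so has measure 0 or 1, which makes
mu1 - mu of constant sign, hence zero. Conversely, conditioning a nonergodic
measure on an invariant set decomposes it. *)

(** Limits of measures are taken as means: finitely additive positive functionals on bounded Borel
    functions. Means pass to ultrafilter limits by compactness of real segments alone, and since
    they accept indicators they give a content on closed sets without Urysohn functions. The price
    is countable additivity: the representing measure is only claimed to agree with the mean on
    continuous functions. Whatever is read off after a limit must therefore be the integral of a
    continuous function. This is why multiplicativity of a random point of the torus is tested by
    the mean of [x_a x_b conj(x_(a+b))], and why moments with exponents at most 2 are enough. The
    detour through the torus is forced because the approximating measures sit on grid points that
    need not be characters.

    Uniqueness of Fourier coefficients avoids density theorems: explicit polynomials turn a real
    trigonometric polynomial into the indicator of a sublevel set.

    Countability of [A] gives countably many multiplicativity conditions, a countable base of the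
    dual and countable unions of translates. *)

Definition borel (X : ptopologicalType) := g_sigma_algebraType (@open X).

(** * Regular Borel probabilities from contents on a compact Hausdorff space *)

Section ContentExtension.
Local Open Scope ereal_scope.
Variables (R : realType) (X : ptopologicalType).
Hypotheses (hX : hausdorff_space X) (cX : compact [set: X]).
Variable m : set X -> R.
Hypotheses (m_mono : forall K L, closed K -> closed L -> K `<=` L -> (m K <= m L)%R)
  (m_sub : forall K L, closed K -> closed L -> (m (K `|` L) <= m K + m L)%R)
  (m_add : forall K L, closed K -> closed L -> K `&` L = set0 ->
     m (K `|` L) = (m K + m L)%R)
  (mT : m setT = 1%R).

Definition inner_content (U : set X) : \bar R :=
  ereal_sup [set (m K)%:E | K in [set K | closed K /\ K `<=` U]].

Definition outer_content (E : set X) : \bar R :=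
  ereal_inf [set inner_content U | U in [set U | open U /\ E `<=` U]].

Let m0 : m set0 = 0%R.
Proof.
have := @m_add set0 set0 closed0 closed0 (setI0 _).
by rewrite setU0 => /eqP; rewrite -subr_eq0 opprD addNKr oppr_eq0 => /eqP.
Qed.

Lemma le_inner_content U V : U `<=` V -> inner_content U <= inner_content V.
Proof.
move=> UV; apply: le_ereal_sup => _ [K [cK KU] <-].
by exists K => //; split => //; exact: subset_trans UV.
Qed.

Lemma inner_content_ub K U : closed K -> K `<=` U -> (m K)%:E <= inner_content U.
Proof. by move=> cK KU; apply: ereal_sup_ubound; exists K. Qed.

Lemma inner_content_ge0 U : 0 <= inner_content U.
Proof. by have := @inner_content_ub set0 U closed0 (@sub0set _ _); rewrite m0. Qed.

Lemma inner_content_le1 U : inner_content U <= 1.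
Proof.
apply: ge_ereal_sup => _ [K [cK KU] <-].
by rewrite lee_fin -mT m_mono//; exact: closedT.
Qed.

Lemma inner_content0 : inner_content set0 = 0.
Proof.
apply/eqP; rewrite eq_le inner_content_ge0 andbT.
apply: ge_ereal_sup => _ [K [cK K0] <-].
by move: K0; rewrite subset0 => ->; rewrite m0.
Qed.

Lemma outer_content_open U : open U -> outer_content U = inner_content U.
Proof.
move=> oU; apply/eqP; rewrite eq_le; apply/andP; split.
  by apply: ereal_inf_lbound; exists U => //; split.
by apply: le_ereal_inf_tmp => _ [V [oV UV] <-]; exact: le_inner_content.
Qed.

(** Normality separates the disjoint closed sets of points of [K] outside [U] and outside [V].
    Removing one of the two neighbourhoods from [K] leaves a part inside [U], removing the other a
    part inside [V], and the two parts cover [K] because the neighbourhoods are disjoint. *)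
Lemma closed_split U V K : open U -> open V -> closed K -> K `<=` U `|` V ->
  exists K1 K2 : set X, [/\ closed K1, closed K2, K1 `<=` U, K2 `<=` V & K = K1 `|` K2].
Proof.
move=> oU oV cK KUV.
have [W1 [W2 [oW1 oW2 KW1 KW2 W12]]] : exists W1 W2 : set X,
    [/\ open W1, open W2, K `\` U `<=` W1, K `\` V `<=` W2 & W1 `&` W2 = set0].
  move/(@normal_openP R X): (compact_normal hX cX) => /(_ (K `\` U) (K `\` V)).
  apply.
  - by apply: closedI => //; exact: open_closedC.
  - by apply: closedI => //; exact: open_closedC.
  - by apply/seteqP; split => // x [[Kx nU] [_ nV]]; case: (KUV x Kx).
exists (K `\` W1), (K `\` W2); split.
- by apply: closedI => //; exact: open_closedC.
- by apply: closedI => //; exact: open_closedC.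
- by move=> x [Kx nO]; apply: contrapT => nU; apply: nO; exact: KW1.
- by move=> x [Kx nO]; apply: contrapT => nU; apply: nO; exact: KW2.
- rewrite -setDIr W12 setD0 //.
Qed.

Lemma inner_contentU U V : open U -> open V ->
  inner_content (U `|` V) <= inner_content U + inner_content V.
Proof.
move=> oU oV; apply: ge_ereal_sup => _ [K [cK KUV] <-].
have [K1 [K2 [cK1 cK2 K1U K2V ->]]] := closed_split oU oV cK KUV.
apply: (@le_trans _ _ (m K1 + m K2)%:E); first by rewrite lee_fin m_sub.
by rewrite EFinD leeD// inner_content_ub.
Qed.

(** A closed subset of the union is compact, so finitely many of the [U n] cover it and finite
    subadditivity suffices. *)
Lemma inner_content_bigcup (U : (set X)^nat) : (forall n, open (U n)) ->
  inner_content (\bigcup_n U n) <= \sum_(n <oo) inner_content (U n).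
Proof.
move=> oU; apply: ge_ereal_sup => _ [K [cK KU] <-].
have : compact K by apply: (subclosed_compact cK cX).
rewrite compact_cover => /(_ nat setT U (fun n _ => oU n) KU) [D _ KD].
have [N DN] : exists N, forall i, i \in D -> (i < N)%N.
  exists (\max_(i <- D) i).+1 => i iD.
  by rewrite ltnS; exact: (@leq_bigmax_seq _ _ xpredT id).
have fin n : open (\big[setU/set0]_(i < n) U i) /\
    inner_content (\big[setU/set0]_(i < n) U i) <= \sum_(0 <= i < n) inner_content (U i).
  elim: n => [|n [oV IH]]; first by rewrite big_ord0 big_geq// inner_content0; split=> //; exact: open0.
  rewrite big_ord_recr big_nat_recr//=; split; first exact: openU.
  by apply: (le_trans (inner_contentU _ _)) => //; rewrite leeD2r.
apply: (@le_trans _ _ (inner_content (\big[setU/set0]_(i < N) U i))).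
  apply: inner_content_ub => // x /KD[i /= iD Uix].
  by rewrite -bigcup_mkord; exists i => //=; exact: DN.
apply: (le_trans (fin N).2); apply: nneseries_lim_ge => n _ _.
exact: inner_content_ge0.
Qed.

Lemma outer_content_ge0 E : 0 <= outer_content E.
Proof.
by apply: le_ereal_inf_tmp => _ [U _ <-]; exact: inner_content_ge0.
Qed.

Lemma outer_content_le1 E : outer_content E <= 1.
Proof.
apply: le_trans (inner_content_le1 setT); apply: ereal_inf_lbound.
by exists setT => //; split => //; exact: openT.
Qed.

Lemma outer_content0 : outer_content set0 = 0.
Proof. by rewrite outer_content_open ?inner_content0//; exact: open0. Qed.

Lemma le_outer_content : {homo outer_content : A B / A `<=` B >-> A <= B}.
Proof.
move=> A B AB; apply: ereal_inf_le_tmp => _ [U [oU BU] <-].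
by exists U => //; split => //; exact: subset_trans BU.
Qed.

Lemma outer_content_fin_num E : outer_content E \is a fin_num.
Proof.
rewrite ge0_fin_numE ?outer_content_ge0//.
by rewrite (le_lt_trans (outer_content_le1 _))// ltry.
Qed.

Lemma outer_content_approx E (e : R) : (0 < e)%R ->
  exists U, [/\ open U, E `<=` U & inner_content U <= outer_content E + e%:E].
Proof.
move=> e0; have [_ [U [oU EU] <-] H] := lb_ereal_inf_adherent e0 (outer_content_fin_num E).
by exists U; split => //; exact: ltW.
Qed.

Lemma outer_content_sigma_subadditive : sigma_subadditive outer_content.
Proof.
move=> F; apply/lee_addgt0Pr => _/posnumP[e].
rewrite [e%:num]splitr.
have [U FU] := choice (fun n => @outer_content_approx (F n) (e%:num / 2 ^+ n.+1)%R
   (divr_gt0 (gt0 e) (exprn_gt0 _ (ltr0Sn _ 1)))).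
apply: (@le_trans _ _ (inner_content (\bigcup_n U n))).
  apply: ereal_inf_lbound; exists (\bigcup_n U n) => //; split.
    by apply: bigcup_open => n _; case: (FU n).
  by apply: subset_bigcup => n _; case: (FU n).
apply: (le_trans (inner_content_bigcup _)).
  by move=> n; case: (FU n).
apply: (@le_trans _ _ (\sum_(n <oo) (outer_content (F n) + (e%:num / (2 ^ n.+1)%:R)%:E))).
  apply: lee_nneseries => [n _ _|n _]; first exact: inner_content_ge0.
  by rewrite natrX; case: (FU n).
rewrite -splitr.
apply: epsilon_trick => // n; exact: outer_content_ge0.
Qed.

HB.instance Definition _ := isOuterMeasure.Build R X outer_content
  outer_content0 outer_content_ge0 le_outer_content outer_content_sigma_subadditive.

Let mu : {outer_measure set X -> \bar R} := outer_content.

(** Let [V] be open and contain [E]. A closed [K] inside both [V] and [U] and a closed [L] inside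
    [V] minus [K] are disjoint, so [m_add] bounds [m K + m L] by the inner content of [V]; suprema
    over [L], then over [K], give the splitting inequality. *)
Lemma open_caratheodory U : open U -> mu.-caratheodory U.
Proof.
move=> oU; apply: le_caratheodory_measurable => E.
apply: le_ereal_inf_tmp => _ [V [oV EV] <-].
rewrite -leeBrDr ?outer_content_fin_num//.
apply: (@le_trans _ _ (inner_content (V `&` U))).
  apply: ereal_inf_lbound; exists (V `&` U) => //; split; first exact: openI.
  by move=> x [/EV].
apply: ge_ereal_sup => _ [K [cK KVU] <-].
rewrite leeBrDr ?outer_content_fin_num// addeC -leeBrDr//.
have : mu (E `&` ~` U) <= inner_content (V `&` ~` K).
  apply: ereal_inf_lbound; exists (V `&` ~` K) => //; split.
    by apply: openI => //; exact: closed_openC.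
  by move=> x [/EV Vx nU]; split=> // /KVU[].
move=> /le_trans; apply; apply: ge_ereal_sup => _ [L [cL LVK] <-].
rewrite leeBrDr// -EFinD -m_add//.
  apply: inner_content_ub; first exact: closedU.
  by move=> x [/LVK[]|/KVU[]].
by apply/seteqP; split => // x [/LVK[]].
Qed.

Lemma borel_caratheodory (B : set (borel X)) : measurable B -> mu.-caratheodory B.
Proof.
apply: smallest_sub => [|U oU]; last exact: open_caratheodory.
split.
- exact: caratheodory_measurable_set0.
- by move=> A mA; rewrite setTD; exact: caratheodory_measurable_setC.
- by move=> F mF; exact: caratheodory_measurable_bigcup.
Qed.

(** The value 0 off the Borel sets is the normalization under which measures that agree on Borel
    sets are equal. *)
Definition borel_content (B : set (borel X)) : \bar R :=
  if `[< measurable B >] then outer_content B else 0.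

Lemma borel_contentE (B : set (borel X)) : measurable B ->
  borel_content B = outer_content B.
Proof. by move=> /asboolP mB; rewrite /borel_content mB. Qed.

Let borel_content0 : borel_content set0 = 0.
Proof. by rewrite borel_contentE// outer_content0. Qed.

Let borel_content_ge0 B : 0 <= borel_content B.
Proof. by rewrite /borel_content; case: ifP => // _; exact: outer_content_ge0. Qed.

Let borel_content_sigma_additive : semi_sigma_additive borel_content.
Proof.
move=> F mF tF mUF; rewrite borel_contentE//.
have := @caratheodory_measure_sigma_additive R X mu F
  (fun n => borel_caratheodory (mF n)) tF (borel_caratheodory mUF).
rewrite (_ : (fun n => _) = (fun n => \sum_(0 <= i < n) borel_content (F i)))//.
by apply/funext => n; apply: eq_bigr => i _; rewrite borel_contentE.
Qed.

HB.instance Definition _ := isMeasure.Build _ (borel X) R borel_content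
  borel_content0 borel_content_ge0 borel_content_sigma_additive.

Let borel_content_setT : borel_content setT = 1.
Proof.
rewrite borel_contentE// outer_content_open; last exact: openT.
apply/eqP; rewrite eq_le inner_content_le1 -mT inner_content_ub//; exact: closedT.
Qed.

HB.instance Definition _ := Measure_isProbability.Build _ _ _ borel_content borel_content_setT.

Lemma outer_contentC B : measurable (B : set (borel X)) ->
  outer_content (~` B) = 1 - outer_content B.
Proof.
move=> mB; have := probability_setC borel_content mB.
by rewrite /= !borel_contentE//; exact: measurableC.
Qed.

(** On closed sets only an inequality is claimed: [m] need not be continuous along decreasing
    sequences, so the outer measure of [K] may exceed [m K]. *)
Lemma content_extension : exists P : probability (borel X) R,
  [/\ forall B, measurable B ->
        P B = ereal_inf [set P U | U in [set U | @open X U /\ B `<=` U]] /\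
        P B = ereal_sup [set P K | K in [set K | @compact X K /\ K `<=` B]],
      forall B, ~ measurable B -> P B = 0 &
      forall K, @closed X K -> (m K)%:E <= P K].
Proof.
have mopen U : @open X U -> measurable (U : set (borel X)).
  by move=> oU; exact: sub_sigma_algebra.
have mclosed K : @closed X K -> measurable (K : set (borel X)).
  by move=> cK; rewrite -[K]setCK; apply: measurableC; apply: mopen; exact: closed_openC.
exists borel_content; split.
- move=> B mB.
  have inf C : measurable (C : set (borel X)) -> borel_content C =
      ereal_inf [set borel_content U | U in [set U | @open X U /\ C `<=` U]].
    move=> mC; rewrite borel_contentE//; congr ereal_inf.
    apply/seteqP; split=> _ [U [oU CU] <-]; exists U => //.
      by rewrite borel_contentE ?outer_content_open//; exact: mopen.
    by rewrite borel_contentE ?outer_content_open//; exact: mopen.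
  split; first exact: inf.
  apply/eqP; rewrite eq_le; apply/andP; split; last first.
    apply: ge_ereal_sup => _ [K [cK KB] <-].
    have mK : measurable (K : set (borel X)) by apply: mclosed; exact: compact_closed.
    by rewrite /= !borel_contentE//; exact: le_outer_content.
  apply/lee_addgt0Pr => _/posnumP[e].
  (* Inner regularity is outer regularity of the complement: the complement of an open set that
     tightly covers the complement of [B] is a compact subset of [B]. *)
  have [U [oU BU Ue]] := outer_content_approx (~` B) (gt0 e).
  have cU : closed (~` U) by exact: open_closedC.
  rewrite /= borel_contentE//.
  apply: (@le_trans _ _ (outer_content (~` U) + e%:num%:E)).
    rewrite (outer_contentC (mopen _ oU)) (outer_content_open oU).
    move: Ue; rewrite outer_contentC//.
    have := outer_content_fin_num B; have := outer_content_fin_num U.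
    rewrite outer_content_open//.
    move=> /fineK <- /fineK <-; rewrite -!EFinB -!EFinD !lee_fin => Ue.
    by lra.
  rewrite leeD2r//; apply: ereal_sup_ubound; exists (~` U).
    by split; [exact: (subclosed_compact cU cX)|rewrite -[B]setCK; exact: subsetC].
  by rewrite /= borel_contentE//; exact: mclosed.
- by move=> B /asboolPn/negbTE nB; rewrite /= /borel_content nB.
- move=> K cK; rewrite /= borel_contentE; last exact: mclosed.
  apply: le_ereal_inf_tmp => _ [U [oU KU] <-].
  exact: inner_content_ub.
Qed.

End ContentExtension.

(** * Bounded measurable functions and means *)

Section BoundedMeasurable.
Variables (R : realType) (d : measure_display) (T : measurableType d).
Implicit Types (f g : T -> R).

Definition bounded_mfun f :=
  measurable_fun [set: T] f /\ exists C, forall x, `|f x| <= C.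

Lemma bounded_mfun_cst c : bounded_mfun (fun=> c).
Proof. by split; [exact: measurable_cst|exists `|c|]. Qed.

Lemma bounded_mfunD f g : bounded_mfun f -> bounded_mfun g ->
  bounded_mfun (fun x => f x + g x).
Proof.
move=> [mf [C fC]] [mg [D gD]]; split; first exact: measurable_funD.
by exists (C + D) => x; rewrite (le_trans (ler_normD _ _))// lerD.
Qed.

Lemma bounded_mfunM f g : bounded_mfun f -> bounded_mfun g ->
  bounded_mfun (fun x => f x * g x).
Proof.
move=> [mf [C fC]] [mg [D gD]]; split; first exact: measurable_funM.
by exists (C * D) => x; rewrite normrM ler_pM.
Qed.

Lemma bounded_mfunZ c f : bounded_mfun f -> bounded_mfun (fun x => c * f x).
Proof. by move=> bf; exact: bounded_mfunM (bounded_mfun_cst c) bf. Qed.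

Lemma bounded_mfunN f : bounded_mfun f -> bounded_mfun (fun x => - f x).
Proof.
by move=> /(bounded_mfunZ (-1)); under eq_fun do rewrite mulN1r.
Qed.

Lemma bounded_mfunB f g : bounded_mfun f -> bounded_mfun g ->
  bounded_mfun (fun x => f x - g x).
Proof. by move=> bf bg; exact: bounded_mfunD bf (bounded_mfunN bg). Qed.

Lemma bounded_mfun_sum I (s : seq I) (P : pred I) (F : I -> T -> R) :
  (forall i, P i -> bounded_mfun (F i)) ->
  bounded_mfun (fun x => \sum_(i <- s | P i) F i x).
Proof.
move=> bF; elim: s => [|i s IH].
  by under eq_fun do rewrite big_nil; exact: bounded_mfun_cst.
under eq_fun do rewrite big_cons.
by case: (boolP (P i)) => // Pi; exact: bounded_mfunD (bF _ Pi) IH.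
Qed.

Lemma bounded_mfun_indic (B : set T) : measurable B -> bounded_mfun \1_B.
Proof.
move=> mB; split; first exact: measurable_indic.
by exists 1 => x; rewrite indicE; case: (_ \in _); rewrite ?normr1 ?normr0.
Qed.

(** No countable additivity is asked, so the notion survives ultrafilter limits. The domain is
    larger than the continuous functions so that a mean can be evaluated on indicators of closed
    sets. *)
Record is_mean (J : (T -> R) -> R) : Prop := IsMean {
  mean_le : forall f g, bounded_mfun f -> bounded_mfun g ->
    (forall x, f x <= g x) -> J f <= J g;
  meanD : forall f g, bounded_mfun f -> bounded_mfun g ->
    J (fun x => f x + g x) = J f + J g;
  meanZ : forall c f, bounded_mfun f -> J (fun x => c * f x) = c * J f;
  mean1 : J (fun=> 1) = 1
}.

Variable J : (T -> R) -> R.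
Hypothesis meanJ : is_mean J.

Lemma mean_cst c : J (fun=> c) = c.
Proof.
have := meanZ meanJ c (bounded_mfun_cst 1).
by rewrite mulr1 (mean1 meanJ) mulr1.
Qed.

Lemma meanN f : bounded_mfun f -> J (fun x => - f x) = - J f.
Proof.
move=> bf; have := meanZ meanJ (-1) bf.
by under eq_fun do rewrite mulN1r; rewrite mulN1r.
Qed.

Lemma meanB f g : bounded_mfun f -> bounded_mfun g ->
  J (fun x => f x - g x) = J f - J g.
Proof. by move=> bf bg; rewrite (meanD meanJ)// ?meanN//; exact: bounded_mfunN. Qed.

Lemma mean_sum I (s : seq I) (P : pred I) (F : I -> T -> R) :
  (forall i, P i -> bounded_mfun (F i)) ->
  J (fun x => \sum_(i <- s | P i) F i x) = \sum_(i <- s | P i) J (F i).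
Proof.
move=> bF; elim: s => [|i s IH].
  by under eq_fun do rewrite big_nil; rewrite mean_cst big_nil.
under eq_fun do rewrite big_cons; rewrite big_cons.
case: (boolP (P i)) => // Pi; rewrite (meanD meanJ) ?IH//; first exact: bF.
exact: bounded_mfun_sum.
Qed.

End BoundedMeasurable.

Section MeanIntegral.
Variables (R : realType) (d : measure_display) (T : measurableType d).
Variable P : probability T R.

Lemma bounded_mfun_integrable (f : T -> R) :
  bounded_mfun f -> P.-integrable setT (EFin \o f).
Proof.
move=> [mf [C fC]]; apply: measurable_bounded_integrable => //.
- by rewrite (le_lt_trans (probability_le1 _ _))// ltry.
- exists C; split; first exact: num_real.
  by move=> x Cx y _; rewrite /= (le_trans (fC y))// ltW.
Qed.

Lemma mean_Rintegral : is_mean (fun f : T -> R => \int[P]_x f x).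
Proof.
split=> [f g bf bg fg|f g bf bg|c f bf|].
- by apply: le_Rintegral => //; exact: bounded_mfun_integrable.
- by rewrite RintegralD//; exact: bounded_mfun_integrable.
- by rewrite RintegralZl//; exact: bounded_mfun_integrable.
- by rewrite Rintegral_cst// [X in fine X]probability_setT mul1r.
Qed.

Lemma Rintegral_indic (B : set T) : measurable B ->
  \int[P]_x (\1_B x) = fine (P B).
Proof. by move=> mB; rewrite /Rintegral integral_indic// setIT. Qed.

End MeanIntegral.

(** * Riesz representation of means on continuous functions *)

Lemma layer_count (R : realType) (n : nat) (y : R) : 0 <= y ->
  \sum_(0 <= k < n) (k.+1%:R <= y)%R%:R <= y.
Proof.
move=> y0; elim: n => [|n IH]; first by rewrite big_geq.
rewrite big_nat_recr//=; case: (leP n.+1%:R y) => ny; last by rewrite addr0.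
apply: (le_trans _ ny); rewrite -natr1 lerD2r.
apply: (@le_trans _ _ (\sum_(0 <= k < n) 1)).
  by apply: ler_sum => k _; rewrite lern1 leq_b1.
by rewrite sumr_const_nat subn0.
Qed.

(** For [0 <= y <= n] the sum is the integer part of [y]; [layer_count] is the matching upper
    bound. *)
Lemma layer_count_ge (R : realType) (n : nat) (y : R) : y <= n%:R ->
  y - 1 <= \sum_(0 <= k < n) (k.+1%:R <= y)%R%:R.
Proof.
elim: n => [|n IH] yn; first by rewrite big_geq//; lra.
rewrite big_nat_recr//=; have [{}yn|ny] := leP y n%:R.
  by rewrite (le_trans (IH yn))// lerDl.
apply: (@le_trans _ _ n%:R).
  by move: yn; rewrite -natr1; lra.
rewrite -[leLHS]addr0 lerD//.
rewrite [leLHS](_ : _ = \sum_(0 <= k < n) 1).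
  rewrite !big_mkord; apply: ler_sum => k _.
  by rewrite (le_trans _ (ltW ny))// ler_nat.
by rewrite sumr_const_nat subn0.
Qed.

Section MeanRepresentation.
Variables (R : realType) (X : ptopologicalType).
Implicit Types (f : X -> R) (J : (X -> R) -> R).
Notation bfun := (@bounded_mfun R _ (borel X)).

Lemma closed_borel (K : set X) : closed K -> measurable (K : set (borel X)).
Proof.
move=> cK; rewrite -[K]setCK; apply: measurableC.
by apply: sub_sigma_algebra; exact: closed_openC.
Qed.

Lemma continuous_borel f : continuous f -> measurable_fun setT (f : borel X -> R).
Proof.
move=> /continuousP cf; apply: (measurability _ (RGenOpens.measurableE R)).
move=> _ [_ [a [b ->] <-]]; rewrite setTI; apply: sub_sigma_algebra.
exact/cf/interval_open.
Qed.

Lemma closed_superlevel f c : continuous f -> closed [set x | c <= f x].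
Proof.
move=> cf; rewrite [X in closed X](_ : _ = f @^-1` [set y | c <= y])//.
by apply: closed_comp => [x _|]; [exact: cf|exact: closed_ge].
Qed.

(* [f] is within [1/N] of the layer sum [1/N * sum_k 1_{f >= (k+1)/N}], whose terms are indicators of closed sets. *)
Lemma mean_le_unit J J' f : is_mean (J : (borel X -> R) -> R) -> is_mean (J' : (borel X -> R) -> R) ->
  (forall K : set X, closed K -> J \1_K <= J' \1_K) ->
  continuous f -> (forall x, 0 <= f x <= 1) -> J f <= J' f.
Proof.
move=> mJ mJ' JJ' cf f01.
have bf : bfun f.
  split; first exact: continuous_borel.
  by exists 1 => x; case/andP: (f01 x) => f0 f1; rewrite ger0_norm.
apply/ler_addgt0Pr => e e0.
have [n ne] : exists n : nat, e^-1 <= n.+1%:R.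
  exists (Num.truncn e^-1); apply/ltW; exact: truncnS_gt.
pose N : R := n.+1%:R.
have N0 : 0 < N by rewrite ltr0n.
pose K k := [set x : X | k.+1%:R / N <= f x].
have cK k : closed (K k) by exact: closed_superlevel.
have bK k : bfun (\1_(K k)).
  by apply: bounded_mfun_indic; exact: closed_borel.
pose g (x : borel X) : R := N^-1 * \sum_(0 <= k < n.+1) \1_(K k) x.
have bS : bfun (fun x => \sum_(0 <= k < n.+1) \1_(K k) x).
  by apply: bounded_mfun_sum => k _; exact: bK.
have bg : bfun g by exact: bounded_mfunZ.
have gE x : g x = N^-1 * \sum_(0 <= k < n.+1) (k.+1%:R <= N * f x)%R%:R.
  congr (_ * _); apply: eq_bigr => k _; rewrite indicE; congr (nat_of_bool _)%:R.
  rewrite [N * f x]mulrC -ler_pdivrMr//.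
  by apply/idP/idP => [/set_mem//|?]; exact: mem_set.
have Ng x : N * g x = \sum_(0 <= k < n.+1) (k.+1%:R <= N * f x)%R%:R.
  by rewrite gE mulrA divff ?mul1r// gt_eqF.
have gf x : g x <= f x.
  rewrite -(ler_pM2l N0) Ng; apply: layer_count.
  by case/andP: (f01 x) => f0 _; exact: mulr_ge0 (ltW N0) f0.
have fg x : f x <= N^-1 + g x.
  rewrite -(ler_pM2l N0) mulrDr Ng divff ?gt_eqF// addrC -lerBlDr.
  apply: layer_count_ge; rewrite ger_pMr//; by case/andP: (f01 x).
have Jg : J g <= J' g.
  rewrite /g (meanZ mJ)// (meanZ mJ')// ler_pM2l ?invr_gt0//.
  rewrite (mean_sum mJ)// (mean_sum mJ')//.
  by apply: ler_sum => k _; exact: JJ'.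
apply: (@le_trans _ _ (N^-1 + J g)).
  rewrite -[X in X + _](mean_cst mJ) -(meanD mJ)//; last exact: bounded_mfun_cst.
  by apply: (mean_le mJ) => //; apply: bounded_mfunD => //; exact: bounded_mfun_cst.
rewrite addrC lerD//.
  by rewrite (le_trans Jg)//; exact: (mean_le mJ').
by rewrite -[e]invrK lef_pV2// posrE invr_gt0.
Qed.

(* The one-sided hypothesis suffices: apply it to [f] and to [- f]. *)
Lemma mean_eq_continuous J J' f : is_mean (J : (borel X -> R) -> R) -> is_mean (J' : (borel X -> R) -> R) ->
  (forall K : set X, closed K -> J \1_K <= J' \1_K) ->
  continuous f -> (exists C, forall x, `|f x| <= C) -> J f = J' f.
Proof.
move=> mJ mJ' JJ'.
have le (h : X -> R) : continuous h -> (exists C, forall x, `|h x| <= C) -> J h <= J' h.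
  move=> ch [C hC].
  have bh : bfun h by split; [exact: continuous_borel|exists C].
  pose c : R := `|C| + 1; have c0 : 0 < c by rewrite ltr_wpDl.
  have hc x : `|h x| <= c.
    by rewrite (le_trans (hC x))// (le_trans (ler_norm _))// lerDl.
  pose u x : R := (2 * c)^-1 * (h x + c).
  have cu : continuous u.
    move=> x; apply: cvgM; first exact: cvg_cst.
    by apply: cvgD; [exact: ch|exact: cvg_cst].
  have bc : bfun (fun=> c) by exact: bounded_mfun_cst.
  have u01 x : 0 <= u x <= 1.
    have := hc x; rewrite ler_norml => /andP[h1 h2].
    rewrite /u mulrC ler_pdivrMr ?mulr_gt0// ler_pdivlMr ?mulr_gt0//.
    by apply/andP; split; lra.
  have := mean_le_unit mJ mJ' JJ' cu u01.
  rewrite /u (meanZ mJ) ?(meanZ mJ')//; try exact: bounded_mfunD.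
  rewrite ler_pM2l ?invr_gt0 ?mulr_gt0//.
  by rewrite (meanD mJ)// (meanD mJ')// (mean_cst mJ) (mean_cst mJ') lerD2r.
move=> cf [C fC]; apply/eqP; rewrite eq_le le//=; last by exists C.
have bf : bfun f by split; [exact: continuous_borel|exists C].
have : J (fun x => - f x) <= J' (fun x => - f x).
  apply: le; first by move=> x; apply: cvgN; exact: cf.
  by exists C => x; rewrite normrN.
by rewrite (meanN mJ)// (meanN mJ')// lerN2.
Qed.

Lemma compact_bounded_continuous f : compact [set: X] -> continuous f ->
  exists C, forall x, `|f x| <= C.
Proof.
move=> cX cf.
have : compact (f @` setT) by apply: continuous_compact => //; exact: continuous_subspaceT.
move=> /compact_bounded[C [_ HC]]; exists (C + 1) => x.
by apply: (HC (C + 1)); [rewrite ltrDl|exists x].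
Qed.

Hypotheses (hX : hausdorff_space X) (cX : compact [set: X]).

Lemma continuous_bounded_mfun f : continuous f -> bfun f.
Proof.
by move=> cf; split; [exact: continuous_borel|exact: compact_bounded_continuous].
Qed.

(** The content [m] is [J] on indicators of closed sets. The extension [P] dominates it there, and
    by [mean_eq_continuous] this one-sided comparison already forces equality on continuous
    functions. On other functions [J] and [P] may differ. *)
Lemma mean_representation J : is_mean (J : (borel X -> R) -> R) ->
  exists P : probability (borel X) R,
  [/\ forall B, measurable B ->
        P B = ereal_inf [set P U | U in [set U | @open X U /\ B `<=` U]] /\
        P B = ereal_sup [set P K | K in [set K | @compact X K /\ K `<=` B]],
      forall B, ~ measurable B -> P B = 0%E &
      forall f, continuous f -> J f = \int[P]_x f x].
Proof.
move=> mJ; pose m (K : set X) := J \1_K.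
have bK K : closed K -> bfun (\1_K).
  by move=> cK; apply: bounded_mfun_indic; exact: closed_borel.
have [|||| P [regP nullP mP]] := @content_extension R X hX cX m.
- move=> K L cK cL KL; apply: (mean_le mJ); [exact: bK|exact: bK|move=> x].
  rewrite !indicE ler_nat; case: (boolP (x \in K)) => // /set_mem Kx.
  by rewrite mem_set//; exact: KL.
- move=> K L cK cL; rewrite -(meanD mJ); [|exact: bK|exact: bK].
  apply: (mean_le mJ); first by apply: bK; exact: closedU.
    by apply: bounded_mfunD; exact: bK.
  move=> x; rewrite !indicE in_setU -natrD ler_nat.
  by case: (x \in K); case: (x \in L).
- move=> K L cK cL KL; rewrite /m -(meanD mJ); [|exact: bK|exact: bK].
  congr J; apply/funext => x; rewrite !indicE in_setU -natrD; congr _%:R.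
  have : (x \in K) && (x \in L) = false by rewrite -in_setI KL in_set0.
  by case: (x \in K); case: (x \in L).
- by rewrite /m indicT; exact: mean1 mJ.
exists P; split => // f cf.
apply: (mean_eq_continuous mJ (mean_Rintegral P)) => //.
  move=> K cK; rewrite Rintegral_indic; last exact: closed_borel.
  rewrite -lee_fin fineK; first exact: mP.
  by apply: fin_num_measure; exact: closed_borel.
exact: compact_bounded_continuous.
Qed.

End MeanRepresentation.

(** * Topology of subspaces, of the complex numbers, of the torus and of the dual *)

Section SubspaceTopology.
Variables (X : topologicalType) (S : set X).

Lemma set_val_continuous : continuous (set_val : S -> X).
Proof. exact: initial_continuous. Qed.

Lemma compact_set_type : compact S -> compact [set: S].
Proof.
move=> cS F PF _.
have [|p [Sp clp]] := cS (fmap (set_val : S -> X) F) _.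
  rewrite /fmap /=; apply: (filterS _ (filterT (F := F))) => x _.
  exact: set_valP.
exists (exist _ p (mem_set Sp)); split => // B C FB [_ [[W oW <-] /= Wp] WC].
have : nbhs p W by exact: open_nbhs_nbhs.
have FB' : fmap (set_val : S -> X) F (set_val @` B).
  by rewrite /fmap /=; apply: filterS FB => x Bx; exists x.
move=> /(clp _ _ FB')[_ [[x Bx <-] Wx]].
by exists x; split => //; exact: WC.
Qed.

Lemma hausdorff_set_type : hausdorff_space X -> hausdorff_space S.
Proof.
move=> hX p q clpq; apply: val_inj; apply: hX => U V Up Vq.
have [x [Ux Vx]] := clpq _ _ (set_val_continuous Up) (set_val_continuous Vq).
by exists (set_val x).
Qed.

End SubspaceTopology.

Section Pointwise.
Variables (I : choiceType) (V : topologicalType).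

Lemma eval_continuous (i : I) : continuous (fun f : {ptws I -> V} => f i).
Proof. exact: (@proj_continuous I (fun=> V) i). Qed.

Lemma ptws_cvg (F : set_system (I -> V)) (f : {ptws I -> V}) : Filter F ->
  (forall i, g i @[g --> F] --> f i) -> F --> f.
Proof.
move=> FF Ff; apply/cvg_sup => i; apply/cvg_image.
  by rewrite eqEsubset; split=> v // _; exists (cst v).
move=> W Wf; exists ((fun g : I -> V => g i) @^-1` W); first exact: Ff.
by rewrite eqEsubset; split => [_ [g Wg <-]//|v Wv]; exists (cst v).
Qed.

End Pointwise.

Section ComplexTopology.
Variable R : realType.
Implicit Types z w : R[i].

Lemma complexReD z w : complex.Re (z + w) = complex.Re z + complex.Re w.
Proof. by case: z w => a b [c d]. Qed.

Lemma complexImD z w : complex.Im (z + w) = complex.Im z + complex.Im w.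
Proof. by case: z w => a b [c d]. Qed.

Lemma complexReN z : complex.Re (- z) = - complex.Re z.
Proof. by case: z. Qed.

Lemma complexImN z : complex.Im (- z) = - complex.Im z.
Proof. by case: z. Qed.

Lemma complexReM z w : complex.Re (z * w) =
  complex.Re z * complex.Re w - complex.Im z * complex.Im w.
Proof. by case: z w => a b [c d]. Qed.

Lemma complexImM z w : complex.Im (z * w) =
  complex.Re z * complex.Im w + complex.Im z * complex.Re w.
Proof. by case: z w => a b [c d]. Qed.

Lemma complex_eqP z w : complex.Re z = complex.Re w ->
  complex.Im z = complex.Im w -> z = w.
Proof. by case: z w => a b [c d] /= -> ->. Qed.

Lemma normC_le_sum z : `|z| <= (`|complex.Re z| + `|complex.Im z|)%:C%C.
Proof.
rewrite normc_def lecR; set a := complex.Re z; set b := complex.Im z.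
rewrite -[leRHS]ger0_norm ?addr_ge0// -sqrtr_sqr ler_wsqrtr//.
rewrite sqrrD !real_normK ?num_real// -addrA [_ *+ 2 + _]addrC addrA lerDl.
by rewrite mulrn_wge0// mulr_ge0.
Qed.

Lemma Re_le_normC z (c : R) : `|z| <= c%:C%C -> `|complex.Re z| <= c.
Proof. by move=> /(le_trans (normc_ge_Re z)); rewrite lecR. Qed.

Lemma Im_le_normC z (c : R) : `|z| <= c%:C%C -> `|complex.Im z| <= c.
Proof.
move=> zc; have := @Re_le_normC (z * 'i%C) c.
rewrite normrM; have -> : `|'i%C : R[i]| = 1.
  by rewrite normc_def /= expr0n expr1n add0r sqrtr1.
by rewrite mulr1 ReiNIm normrN; exact.
Qed.

Lemma complex_posP (e : R[i]) : 0 < e -> exists2 d : R, 0 < d & e = d%:C%C.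
Proof.
case: e => a b; rewrite ltcE /= => /andP[/eqP -> a0]; by exists a.
Qed.

Lemma cvg_complexP (T : Type) (F : set_system T) (f : T -> R[i]) (l : R[i]) : Filter F ->
  ((f x : R[i]^o) @[x --> F] --> (l : R[i]^o)) <->
  (complex.Re (f x) @[x --> F] --> complex.Re l) /\
  (complex.Im (f x) @[x --> F] --> complex.Im l).
Proof.
move=> FF; split.
  move=> /cvgrPdist_le fl; split; apply/cvgrPdist_le => e e0.
    have := fl e%:C%C; rewrite ltcR => /(_ e0); apply: filterS => x.
    by move=> /Re_le_normC; rewrite complexReD complexReN.
  have := fl e%:C%C; rewrite ltcR => /(_ e0); apply: filterS => x.
  by move=> /Im_le_normC; rewrite complexImD complexImN.
move=> [/cvgrPdist_le fr /cvgrPdist_le fi]; apply/cvgrPdist_le => e.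
move=> /complex_posP[d d0 ->].
have d20 : 0 < d / 2 by rewrite divr_gt0.
apply: filterS2 (fr _ d20) (fi _ d20) => x h1 h2.
apply: (le_trans (normC_le_sum _)); rewrite lecR (splitr d).
by rewrite complexReD complexReN complexImD complexImN lerD.
Qed.

Lemma complex_hausdorff : hausdorff_space R[i]^o.
Proof. exact: norm_hausdorff. Qed.

Lemma unit_circle_compact : compact [set z : R[i]^o | `|z| = 1].
Proof.
pose h (p : R * R) : R[i]^o := (p.1 +i* p.2)%C.
have ch : continuous h.
  move=> p; apply/(@cvg_complexP _ _ h); split => /=.
    exact: cvg_fst.
  exact: cvg_snd.
have cK : compact (h @` (`[-1, 1]%classic `*` `[-1, 1]%classic)).
  apply: continuous_compact; first exact: continuous_subspaceT.
  by apply: compact_setX; exact: segment_compact.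
apply: (subclosed_compact _ cK).
  rewrite [X in closed X](_ : _ = (fun z : R[i]^o => `|z|) @^-1` [set 1])//.
  apply: closed_comp => [z _|]; first exact: norm_continuous.
  exact/accessible_closed_set1/hausdorff_accessible/norm_hausdorff.
move=> z /= z1; exists (complex.Re z, complex.Im z) => /=; last by case: (z).
by split; rewrite /= in_itv/= -ler_norml; [apply: Re_le_normC|apply: Im_le_normC]; rewrite z1.
Qed.

End ComplexTopology.

Section ComplexContinuous.
Variables (R : realType) (T : topologicalType).
Implicit Types f g : T -> R[i].

Definition complex_continuous f :=
  continuous (fun x => complex.Re (f x)) /\ continuous (fun x => complex.Im (f x)).

Lemma complex_continuousE f :
  continuous (f : T -> R[i]^o) <-> complex_continuous f.
Proof.
split=> [cf|[cr ci] x]; last by apply/cvg_complexP; split; [exact: cr|exact: ci].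
by split=> x; have /cvg_complexP[] := cf x.
Qed.

Lemma complex_continuous_cst (c : R[i]) : complex_continuous (fun=> c).
Proof. by split=> x; exact: cvg_cst. Qed.

Lemma complex_continuousB f g : complex_continuous f -> complex_continuous g ->
  complex_continuous (fun x => f x - g x).
Proof.
move=> [fr fi] [gr gi]; split=> x.
  under eq_fun do rewrite complexReD complexReN.
  by apply: cvgB; [exact: fr|exact: gr].
under eq_fun do rewrite complexImD complexImN.
by apply: cvgB; [exact: fi|exact: gi].
Qed.

Lemma complex_continuousM f g : complex_continuous f -> complex_continuous g ->
  complex_continuous (fun x => f x * g x).
Proof.
move=> [fr fi] [gr gi]; split=> x.
  under eq_fun do rewrite complexReM.
  by apply: cvgB; apply: cvgM; [exact: fr|exact: gr|exact: fi|exact: gi].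
under eq_fun do rewrite complexImM.
by apply: cvgD; apply: cvgM; [exact: fr|exact: gi|exact: fi|exact: gr].
Qed.

Lemma complex_continuous_conj f : complex_continuous f ->
  complex_continuous (fun x => Num.conj (f x)).
Proof.
move=> [fr fi]; split=> x.
  rewrite (_ : (fun x => _) = (fun x => complex.Re (f x))); first exact: fr.
  by apply/funext => y; case: (f y).
rewrite (_ : (fun x => _) = (fun x => - complex.Im (f x))).
  by apply: cvgN; exact: fi.
by apply/funext => y; case: (f y).
Qed.

Lemma complex_continuous_closed0 f : complex_continuous f -> closed [set x | f x = 0].
Proof.
move=> [fr fi].
rewrite (_ : [set _ | _] = (fun x => complex.Re (f x)) @^-1` [set 0] `&`
   (fun x => complex.Im (f x)) @^-1` [set 0]).
  apply: closedI; apply: closed_comp => [x _|]; [exact: fr| |exact: fi|].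
    exact/accessible_closed_set1/hausdorff_accessible/Rhausdorff.
  exact/accessible_closed_set1/hausdorff_accessible/Rhausdorff.
apply/seteqP; split=> x /=; first by move=> ->.
by move=> [r0 i0]; apply: complex_eqP.
Qed.

End ComplexContinuous.

Section Torus.
Variables (R : realType) (I : choiceType).

(** The index type is left general: over [nat] the torus carries the approximating measures, over
    [A] it contains the characters as a closed subset, which makes the dual compact. *)
Definition torus_set : set {ptws I -> R[i]^o} :=
  [set x | forall i, `|x i| = 1].

Definition torus : Type := torus_set.
HB.instance Definition _ := Topological.on torus.

Lemma one_torus : torus_set (fun=> 1).
Proof. by move=> i; rewrite normr1. Qed.

HB.instance Definition _ :=
  isPointed.Build torus (exist _ (fun=> 1) (mem_set one_torus) : torus_set).

Definition torus_fun (x : torus) : I -> R[i] := set_val x.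

Lemma torus_norm (x : torus) i : `|torus_fun x i| = 1.
Proof. exact: (set_valP x). Qed.

Lemma torus_set_compact : compact torus_set.
Proof.
by apply: (@tychonoff I (fun=> R[i]^o) (fun=> [set z | `|z| = 1])) => i; exact: unit_circle_compact.
Qed.

Lemma ptws_hausdorff : hausdorff_space {ptws I -> R[i]^o}.
Proof. by apply: hausdorff_product => i; exact: complex_hausdorff. Qed.

Lemma torus_compact : compact [set: torus].
Proof. by apply: compact_set_type; exact: torus_set_compact. Qed.

Lemma torus_hausdorff : hausdorff_space torus.
Proof. by apply: hausdorff_set_type; exact: ptws_hausdorff. Qed.

Lemma torus_eval_continuous i : continuous (fun x : torus => torus_fun x i : R[i]^o).
Proof.
move=> x; apply: (@continuous_comp torus {ptws I -> R[i]^o} _ set_val (fun f => f i)).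
  exact: set_val_continuous.
exact: eval_continuous.
Qed.

End Torus.

Section DualTopology.
Variables (R : realType) (k : fieldType) (A : nilAlgType k).

Lemma character_set_closed : closed (@character_set R k A).
Proof.
rewrite (_ : @character_set R k A = \bigcap_(p : A * A)
  [set th : {ptws A -> R[i]^o} | th (p.1 + p.2) - th p.1 * th p.2 = 0]
  `&` @torus_set R A); last first.
  apply/seteqP; split=> [th [thD th1]|th [thD th1]].
    split; last exact: th1.
    by move=> [a b] _ /=; rewrite thD subrr.
  split => [a b|]; last exact: th1.
  by have := thD (a, b) I; move/eqP; rewrite subr_eq0 => /eqP.
apply: closedI; last by apply: compact_closed; [exact: ptws_hausdorff|exact: torus_set_compact].
apply: closed_bigI => -[a b] _ /=.
apply: complex_continuous_closed0; apply: complex_continuousB.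
  by apply/complex_continuousE; exact: eval_continuous.
by apply: complex_continuousM; apply/complex_continuousE; exact: eval_continuous.
Qed.

Lemma dual_compact : compact [set: dual R A].
Proof.
apply: compact_set_type; apply: (subclosed_compact character_set_closed (@torus_set_compact R A)).
by move=> th [_ th1].
Qed.

Lemma dual_hausdorff : hausdorff_space (dual R A).
Proof. by apply: hausdorff_set_type; exact: ptws_hausdorff. Qed.

Lemma dual_eval_continuous (a : A) : continuous (fun th : dual R A => th a : R[i]^o).
Proof.
move=> x; apply: (@continuous_comp (dual R A) {ptws A -> R[i]^o} _ set_val (fun f => f a)).
  exact: set_val_continuous.
exact: eval_continuous.
Qed.

Lemma dualD (th : dual R A) a b : th (a + b) = th a * th b.
Proof. by have [+ _] := set_valP (th : @character_set R k A); exact. Qed.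

Lemma dual_norm (th : dual R A) a : `|th a| = 1.
Proof. by have [_ +] := set_valP (th : @character_set R k A); exact. Qed.

Lemma dual_act_continuous gam : continuous (@dual_act R k A gam).
Proof.
apply: continuous_comp_initial => th; apply: ptws_cvg => [|a].
  exact: (@fmap_filter (dual R A) _ (set_val \o dual_act gam) (nbhs th) (nbhs_filter th)).
exact: dual_eval_continuous.
Qed.

End DualTopology.

(** * Polynomial approximation of a step function *)

Lemma bernoulli_ge (R : realDomainType) (x : R) n : x <= 1 -> 1 - n%:R * x <= (1 - x) ^+ n.
Proof.
move=> x1; have x1' : 0 <= 1 - x by rewrite subr_ge0.
elim: n => [|n IH]; first by rewrite mul0r subr0 expr0.
rewrite exprSr; have [nx|nx] := leP (n%:R * x) 1; last first.
  apply: (@le_trans _ _ 0); last by rewrite mulr_ge0// exprn_ge0.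
  rewrite subr_le0 (le_trans (ltW nx))// ler_wpM2r ?ler_nat//.
  by rewrite leNgt; apply/negP => x0; move: nx; rewrite ltNge (le_trans _ ler01)// mulr_ge0_le0// ltW.
apply: (le_trans _ (ler_wpM2r x1' IH)).
rewrite mulrBr mulr1 mulrBl mul1r opprB -natr1 mulrDl mul1r opprD.
rewrite [leRHS](_ : _ = 1 - n%:R * x - x + n%:R * x * x); last by ring.
rewrite addrA lerDl -mulrA mulr_ge0// ?ler0n//.
by rewrite -expr2 sqr_ge0.
Qed.

(** Multiply by [(1 + x)^n], which is at least [1 + n x]: the product [(1 - x^2)^n] is at most 1. *)
Lemma bernoulli_le (R : realFieldType) (x : R) n : 0 <= x <= 1 ->
  (1 - x) ^+ n <= (1 + n%:R * x)^-1.
Proof.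
move=> /andP[x0 x1]; have x1' : 0 <= 1 - x by rewrite subr_ge0.
have p0 : 0 < 1 + n%:R * x by rewrite ltr_pwDl// mulr_ge0.
rewrite -[leRHS]mul1r ler_pdivlMr//.
apply: (@le_trans _ _ ((1 - x) ^+ n * (1 + x) ^+ n)).
  rewrite ler_wpM2l ?exprn_ge0//.
  have := @bernoulli_ge R (- x) n; rewrite mulrN !opprK; apply.
  by rewrite (le_trans _ ler01)// oppr_le0.
rewrite -exprMn -subr_sqr expr1n exprn_ile1//.
  by rewrite subr_ge0 exprn_ile1.
by rewrite lerBlDr lerDl sqr_ge0.
Qed.

(* Kuhn's polynomials [(1 - u^n)^(2^n)] tend to 1 below 1/2 and to 0 above; the second factor kills the limit at 1/2. *)
Definition kuhn (R : realType) (n : nat) (u : R) : R :=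
  (1 - u ^+ n) ^+ (2 ^ n) * (1 - (1 - (u - 2^-1) ^+ 2) ^+ n).

Lemma kuhn01 (R : realType) n (u : R) : 0 <= u <= 1 -> 0 <= kuhn n u <= 1.
Proof.
move=> /andP[u0 u1].
have un0 : 0 <= u ^+ n by rewrite exprn_ge0.
have un1 : u ^+ n <= 1 by rewrite exprn_ile1.
have v01 : 0 <= 1 - (u - 2^-1) ^+ 2 <= 1.
  rewrite (_ : (u - 2^-1) ^+ 2 = 4^-1 - u * (1 - u)); last by field.
  have := mulr_ge0 u0 (_ : 0 <= 1 - u); rewrite subr_ge0 => /(_ u1) uu.
  have := sqr_ge0 (u - 2^-1).
  rewrite (_ : (u - 2^-1) ^+ 2 = 4^-1 - u * (1 - u)); last by field.
  by move=> v0; apply/andP; split; lra.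
case/andP: v01 => v0 v1.
have vn0 : 0 <= (1 - (u - 2^-1) ^+ 2) ^+ n by rewrite exprn_ge0.
have vn1 : (1 - (u - 2^-1) ^+ 2) ^+ n <= 1 by rewrite exprn_ile1.
rewrite /kuhn mulr_ge0 ?exprn_ge0 ?subr_ge0//= mulr_ile1 ?exprn_ge0 ?subr_ge0//.
  by rewrite exprn_ile1 ?subr_ge0// lerBlDr lerDl.
by rewrite lerBlDr lerDl.
Qed.

(** The two Bernoulli inequalities place the first factor between [1 - (2u)^n] and 1 for [u < 1/2],
    and between 0 and [(2u)^(-n)] for [u > 1/2]. Away from 1/2 the second factor tends to 1; at 1/2
    it vanishes for every [n]. *)
Lemma cvg_kuhn (R : realType) (u : R) : 0 <= u <= 1 ->
  kuhn n u @[n --> \oo] --> ((u < 2^-1)%R%:R : R).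
Proof.
move=> /andP[u0 u1].
have un01 n : 0 <= u ^+ n <= 1 by rewrite exprn_ge0 ?exprn_ile1.
have [->|u2] := eqVneq u 2^-1.
  rewrite ltxx; apply: cvg_near_cst; near=> n.
  by rewrite /kuhn subrr expr0n/= subr0 expr1n subrr mulr0.
have v2 : `|1 - (u - 2^-1) ^+ 2| < 1.
  have : 0 < (u - 2^-1) ^+ 2 by rewrite exprn_even_gt0//= subr_eq0.
  by move=> v0; rewrite ger0_norm; nra.
suff c1 : (1 - u ^+ n) ^+ (2 ^ n) @[n --> \oo] --> ((u < 2^-1)%R%:R : R).
  rewrite -[X in _ --> X]mulr1; apply: cvgM; first exact: c1.
  rewrite -[X in _ --> X]subr0; apply: cvgB; first exact: cvg_cst.
  exact: cvg_expr.
have [ult|] := ltP u 2^-1.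
  apply: (@squeeze_cvgr _ _ _ _ (fun n => 1 - (2 * u) ^+ n) (fun=> 1)).
  - near=> n; have /andP[un0 un1] := un01 n.
    rewrite exprn_ile1 ?subr_ge0 ?lerBlDr ?lerDl// andbT.
    have := @bernoulli_ge R (u ^+ n) (2 ^ n) un1.
    by rewrite natrX -exprMn lerBlDr.
  - rewrite -[X in _ --> X]subr0; apply: cvgB; first exact: cvg_cst.
    by apply: cvg_expr; rewrite ger0_norm; nra.
  - exact: cvg_cst.
rewrite le_eqVlt eq_sym (negbTE u2) /= => ugt.
have u20 : 0 < 2 * u by nra.
apply: (@squeeze_cvgr _ _ _ _ (fun=> 0) (fun n => (2 * u)^-1 ^+ n)).
- near=> n; have /andP[un0 un1] := un01 n.
  rewrite exprn_ge0 ?subr_ge0//=.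
  apply: (le_trans (bernoulli_le _ (un01 n))).
  rewrite natrX -exprMn exprVn lef_pV2 ?posrE ?exprn_gt0// ?lerDr//.
  by rewrite ltr_pwDl// exprn_ge0// ltW.
- exact: cvg_cst.
- apply: cvg_expr; rewrite ger0_norm ?invr_ge0 ?ltW//.
  by rewrite invf_lt1//; lra.
Unshelve. all: by end_near. Qed.

(** * Trigonometric polynomials and uniqueness of Fourier coefficients *)

Section TrigPolynomials.
Variables (R : realType) (k : fieldType) (A : nilAlgType k).
Notation D := (borel_dual R A).
Implicit Types (f g : D -> R) (c d : R[i]) (a b : A) (th : dual R A).

Lemma dual0 th : th 0 = 1.
Proof.
have t0 : th 0 != 0 by rewrite -normr_eq0 dual_norm oner_eq0.
by apply: (mulfI t0); rewrite -dualD addr0 mulr1.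
Qed.

Lemma dualN th a : th (- a) = Num.conj (th a).
Proof.
have ta : th a != 0 by rewrite -normr_eq0 dual_norm oner_eq0.
apply: (mulfI ta); rewrite -dualD subrr dual0.
by rewrite -normCK dual_norm expr1n.
Qed.

Definition trig (s : seq (R[i] * A)) (th : D) : R :=
  \sum_(p <- s) complex.Re (p.1 * (th : dual R A) p.2).

Definition is_trig f := exists s, f =1 trig s.

Lemma is_trig_term c a : is_trig (fun th => complex.Re (c * (th : dual R A) a)).
Proof. by exists [:: (c, a)] => th; rewrite /trig big_seq1. Qed.

Lemma is_trig_cst (r : R) : is_trig (fun=> r).
Proof.
by exists [:: (r%:C%C, 0)] => th; rewrite /trig big_seq1 /= dual0 mulr1.
Qed.

Lemma is_trigD f g : is_trig f -> is_trig g -> is_trig (fun x => f x + g x).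
Proof.
move=> [s fs] [t gt]; exists (s ++ t) => th.
by rewrite /trig big_cat /= fs gt.
Qed.

(** Product-to-sum formula; it makes the real trigonometric polynomials closed under
    multiplication. *)
Lemma complexReM_half c d : complex.Re c * complex.Re d =
  complex.Re (2^-1%:C%C * (c * d)) + complex.Re (2^-1%:C%C * (c * Num.conj d)).
Proof.
by case: c d => c1 c2 [d1 d2]; rewrite !complexReM !complexImM /=; field.
Qed.

Lemma is_trig_mul_term c a g : is_trig g ->
  is_trig (fun th => complex.Re (c * (th : dual R A) a) * g th).
Proof.
move=> [t gt].
exists (flatten [seq [:: (2^-1%:C%C * (c * p.1), a + p.2);
                         (2^-1%:C%C * (c * Num.conj p.1), a - p.2)] | p <- t]) => th.
rewrite /trig gt /trig mulr_sumr big_flatten big_map; apply: eq_bigr => -[d b] _ /=.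
rewrite complexReM_half big_cons big_seq1 /=; congr (complex.Re _ + complex.Re _).
  by rewrite dualD; ring.
by rewrite dualD dualN rmorphM /=; ring.
Qed.

Lemma is_trigM f g : is_trig f -> is_trig g -> is_trig (fun x => f x * g x).
Proof.
move=> [s fs] tg; rewrite (_ : (fun x => _) = (fun x => trig s x * g x)); last first.
  by apply/funext => x; rewrite fs.
elim: s {f fs} => [|[c a] s IH].
  rewrite (_ : (fun x => _) = (fun=> 0)); first exact: is_trig_cst.
  by apply/funext => x; rewrite /trig big_nil mul0r.
rewrite (_ : (fun x => _) = (fun x => complex.Re (c * (x : dual R A) a) * g x + trig s x * g x)).
  by apply: is_trigD => //; exact: is_trig_mul_term.
by apply/funext => x; rewrite /trig big_cons mulrDl.
Qed.

Lemma is_trigN f : is_trig f -> is_trig (fun x => - f x).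
Proof.
move=> /(is_trigM (is_trig_cst (-1))); congr is_trig.
by apply/funext => x; rewrite mulN1r.
Qed.

Lemma is_trigB f g : is_trig f -> is_trig g -> is_trig (fun x => f x - g x).
Proof. by move=> tf tg; exact: is_trigD tf (is_trigN tg). Qed.

Lemma is_trigX f n : is_trig f -> is_trig (fun x => f x ^+ n).
Proof.
move=> tf; elim: n => [|n IH].
  by rewrite (_ : (fun x => _) = (fun=> 1))//; exact: is_trig_cst.
rewrite (_ : (fun x => _) = (fun x => f x * f x ^+ n)); first exact: is_trigM.
by apply/funext => x; rewrite exprS.
Qed.

Lemma is_trig_kuhn f n : is_trig f -> is_trig (fun x => kuhn n (f x)).
Proof.
move=> tf; apply: is_trigM.
  by apply/is_trigX/is_trigB; [exact: is_trig_cst|exact: is_trigX].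
apply: is_trigB; first exact: is_trig_cst.
apply/is_trigX/is_trigB; first exact: is_trig_cst.
by apply/is_trigX/is_trigB => //; exact: is_trig_cst.
Qed.

Lemma dual_Re_continuous a : continuous (fun th => complex.Re (th a)).
Proof. by have /complex_continuousE[] := @dual_eval_continuous R k A a. Qed.

Lemma dual_Im_continuous a : continuous (fun th => complex.Im (th a)).
Proof. by have /complex_continuousE[] := @dual_eval_continuous R k A a. Qed.

Lemma bounded_mfun_Re a : bounded_mfun (fun th : D => complex.Re ((th : dual R A) a)).
Proof.
apply: (@continuous_bounded_mfun R (dual R A)); first exact: dual_compact.
exact: dual_Re_continuous.
Qed.

Lemma bounded_mfun_Im a : bounded_mfun (fun th : D => complex.Im ((th : dual R A) a)).
Proof.
apply: (@continuous_bounded_mfun R (dual R A)); first exact: dual_compact.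
exact: dual_Im_continuous.
Qed.

Lemma bounded_mfun_term c a : bounded_mfun (fun th : D => complex.Re (c * (th : dual R A) a)).
Proof.
under eq_fun do rewrite complexReM.
by apply: bounded_mfunB; apply: bounded_mfunZ; [exact: bounded_mfun_Re|exact: bounded_mfun_Im].
Qed.

Lemma bounded_mfun_trig f : is_trig f -> bounded_mfun f.
Proof.
move=> [s /funext ->]; apply: bounded_mfun_sum => -[c a] _.
exact: bounded_mfun_term.
Qed.

Variables P Q : probability D R.
Hypotheses (PQRe : forall a, \int[P]_th complex.Re ((th : dual R A) a) =
    \int[Q]_th complex.Re ((th : dual R A) a))
  (PQIm : forall a, \int[P]_th complex.Im ((th : dual R A) a) =
    \int[Q]_th complex.Im ((th : dual R A) a)).

Lemma Rintegral_trig_eq f : is_trig f -> \int[P]_th f th = \int[Q]_th f th.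
Proof.
move=> [s /funext ->].
rewrite (mean_sum (mean_Rintegral P)) ?(mean_sum (mean_Rintegral Q));
  try by move=> p _; exact: bounded_mfun_term.
apply: eq_bigr => -[c a] _ /=.
have bR := bounded_mfunZ (complex.Re c) (bounded_mfun_Re a).
have bI := bounded_mfunZ (complex.Im c) (bounded_mfun_Im a).
under eq_Rintegral do rewrite complexReM.
under [RHS]eq_Rintegral do rewrite complexReM.
rewrite (meanB (mean_Rintegral P))// (meanB (mean_Rintegral Q))//.
rewrite !(meanZ (mean_Rintegral P)) ?(meanZ (mean_Rintegral Q)) ?PQRe ?PQIm//;
  by [exact: bounded_mfun_Re|exact: bounded_mfun_Im].
Qed.

(* Bounded limits of trigonometric polynomials are stable under products, so these sets form a pi-system on which [P] and [Q] agree. *)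
Definition trig_limit (B : set D) := measurable B /\
  exists f : nat -> D -> R, [/\ forall n, is_trig (f n),
    forall n th, 0 <= f n th <= 1 &
    forall th, f n th @[n --> \oo] --> (\1_B th : R)].

Lemma trig_limitI B C : trig_limit B -> trig_limit C -> trig_limit (B `&` C).
Proof.
move=> [mB [f [tf f01 fB]]] [mC [g [tg g01 gC]]]; split; first exact: measurableI.
exists (fun n th => f n th * g n th); split.
- by move=> n; exact: is_trigM.
- move=> n th; have /andP[f0 f1] := f01 n th; have /andP[g0 g1] := g01 n th.
  by rewrite mulr_ge0//= mulr_ile1.
- move=> th; rewrite indicI; apply: cvgM; [exact: fB|exact: gC].
Qed.

Lemma trig_limitT : trig_limit setT.
Proof.
split => //; exists (fun _ _ => 1); split => [n|n th|th].
- exact: is_trig_cst.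
- by rewrite ler01 lexx.
- by rewrite indicT; exact: cvg_cst.
Qed.

Lemma trig_limit_lt f (r : R) : is_trig f -> trig_limit [set th | f th < r].
Proof.
move=> tf; have [mf [C fC]] := bounded_mfun_trig tf.
(* [M] exceeds every value of [|f - r|], so the affine map [u] takes values in [0, 1] and sends the
   threshold [r] to 1/2, where the limit of [kuhn] jumps. *)
pose M : R := `|C| + `|r| + 1; have M0 : 0 < M by rewrite ltr_wpDl// addr_ge0.
pose u (th : D) : R := (2 * M)^-1 * (f th - r) + 2^-1.
have u01 th : 0 <= u th <= 1.
  have := fC th; rewrite ler_norml => /andP[f1 f2].
  have := ler_norm C; have := ler_norm r; have := ler_norm (- r); rewrite normrN => r1 r2 C1.
  have : -1 / 2 <= (2 * M)^-1 * (f th - r) <= 1 / 2.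
    rewrite [_ * (f th - r)]mulrC; apply/andP; split.
      by rewrite ler_pdivlMr ?mulr_gt0// /M; lra.
    by rewrite ler_pdivrMr ?mulr_gt0// /M; lra.
  by rewrite /u => /andP[? ?]; apply/andP; split; lra.
have ult th : (u th < 2^-1) = (f th < r).
  rewrite /u -subr_lt0 addrK pmulr_rlt0 ?invr_gt0 ?mulr_gt0//.
  by rewrite subr_lt0.
have tu : is_trig u.
  apply: is_trigD; last exact: is_trig_cst.
  by apply: is_trigM; [exact: is_trig_cst|apply: is_trigB => //; exact: is_trig_cst].
split.
  have -> : [set th | f th < r] = f @^-1` [set x | x < r] by [].
  rewrite -[X in measurable X]setTI; apply: mf => //.
  by rewrite -[X in measurable X]set_itvNyo; exact: measurable_itv.
exists (fun n th => kuhn n (u th)); split.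
- by move=> n; exact: is_trig_kuhn.
- by move=> n th; exact: kuhn01.
- move=> th; rewrite indicE.
  rewrite (_ : (th \in _) = (u th < 2^-1)); first exact: cvg_kuhn.
  by rewrite ult; apply/idP/idP => [/set_mem//|?]; exact: mem_set.
Qed.

Lemma trig_limit_eq B : trig_limit B -> P B = Q B.
Proof.
move=> [mB [f [tf f01 fB]]].
have cv (S : probability D R) : (\int[S]_th (f n th)%:E @[n --> \oo] --> S B)%E.
  have := @dominated_convergence _ D R S setT measurableT
    (fun n th => (f n th)%:E) (fun th => (\1_B th)%:E) (fun=> 1%E).
  rewrite integral_indic// setIT; case=> //.
  - by move=> n; apply/measurable_EFinP; case: (bounded_mfun_trig (tf n)).
  - exact/measurable_EFinP/measurable_indic.
  - by apply: aeW => th _; apply: cvg_EFin => //; [exact: nearW|exact: fB].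
  - by apply: (bounded_mfun_integrable S (bounded_mfun_cst _ 1)).
  - apply: aeW => th n _ /=; rewrite lee_fin.
    by have /andP[f0 f1] := f01 n th; rewrite ger0_norm.
have PQn n : (\int[P]_th (f n th)%:E = \int[Q]_th (f n th)%:E)%E.
  have iP := integrable_fin_num measurableT (bounded_mfun_integrable P (bounded_mfun_trig (tf n))).
  have iQ := integrable_fin_num measurableT (bounded_mfun_integrable Q (bounded_mfun_trig (tf n))).
  by rewrite -(fineK iP) -(fineK iQ); congr EFin; exact: Rintegral_trig_eq.
have := cv P; under eq_fun do rewrite PQn.
by move=> cP; exact: (cvg_unique _ cP (cv Q)).
Qed.

End TrigPolynomials.

Section FourierUniqueness.
Variables (R : realType) (k : fieldType) (A : nilAlgType k).
Hypothesis A_countable : countable [set: A].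
Notation D := (borel_dual R A).

Lemma countable_enumeration : exists e : nat -> A, forall a, exists n, e n = a.
Proof.
have /countable_injP[f finj] := A_countable.
exists (fun n => xget 0 [set a | f a = n]) => a; exists (f a).
have : [set b | f b = f a] (xget 0 [set b | f b = f a]) by exact: xgetI.
by move=> /= /finj; apply; rewrite in_setT.
Qed.

Let e := projT1 (cid countable_enumeration).
Let eP a : exists n, e n = a. Proof. exact: (projT2 (cid countable_enumeration)). Qed.

(* A code [(n, (s, i), q)] stands for the open half plane [± Re (th (e n)) < q] or [± Im (th (e n)) < q]. *)
Let code := (nat * (bool * bool) * rat)%type.

Let coord (p : bool * bool) : R[i] :=
  match p with
  | (false, false) => 1 | (true, false) => - 1
  | (false, true) => 'i%C | (true, true) => - 'i%C
  end.

Let half (c : code) : set (dual R A) :=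
  [set th | complex.Re (coord c.1.2 * th (e c.1.1)) < ratr c.2].

Let basic (s : seq code) : set (dual R A) := [set th | forall c, c \in s -> half c th].

Let basic_trig_limit s : trig_limit (basic s : set D).
Proof.
elim: s => [|c s IH].
  rewrite (_ : basic [::] = setT); first exact: trig_limitT.
  by apply/seteqP; split.
rewrite (_ : basic (c :: s) = half c `&` basic s).
  by apply: trig_limitI => //; apply: trig_limit_lt; exact: is_trig_term.
apply/seteqP; split=> [th H|th [h1 h2] d].
  by split=> [|d ds]; apply: H; rewrite inE ?eqxx ?ds ?orbT.
by rewrite inE => /orP[/eqP ->//|]; exact: h2.
Qed.

Let separation (th0 th : dual R A) : th <> th0 -> exists c : code,
  half c th0 /\ complex.Re (coord c.1.2 * th (e c.1.1)) > ratr c.2.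
Proof.
move=> neq; have [a na] : exists a, th a <> th0 a.
  apply: contrapT => H; apply: neq; apply: val_inj; apply/funext => a.
  by apply: contrapT => na; apply: H; exists a.
have [n en] := eP a.
have [p hp] : exists p, complex.Re (coord p * th0 a) < complex.Re (coord p * th a).
  have [H0|] := eqVneq (complex.Re (th0 a)) (complex.Re (th a)); last first.
    rewrite neq_lt => /orP[H|H].
      by exists (false, false); rewrite /= !mul1r.
    by exists (true, false); rewrite /= !mulN1r !complexReN ltrN2.
  have : complex.Im (th0 a) != complex.Im (th a).
    by apply/eqP => Hi; apply: na; apply: complex_eqP; rewrite ?Hi ?H0.
  rewrite neq_lt => /orP[Hi|Hi].
    exists (true, true); rewrite /= !mulNr !complexReN !complexReM /=.
    by rewrite !mul0r !mul1r !sub0r !opprK.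
  exists (false, true); rewrite /= !complexReM /=.
  by rewrite !mul0r !mul1r !sub0r ltrN2.
have [q] := rat_in_itvoo hp; rewrite in_itv /= => /andP[q1 q2].
by exists (n, p, q); rewrite /half /= en.
Qed.

Let half_open (c : code) :
  open [set th : dual R A | ratr c.2 < complex.Re (coord c.1.2 * th (e c.1.1))].
Proof.
have cf : continuous (fun th : dual R A => complex.Re (coord c.1.2 * th (e c.1.1))).
  have [] := @complex_continuousM R _ (fun=> coord c.1.2) (fun th : dual R A => th (e c.1.1)) => //.
    exact: complex_continuous_cst.
  exact/complex_continuousE/dual_eval_continuous.
by move/continuousP : cf => /(_ _ (@open_gt R (ratr c.2))).
Qed.

(** Each point outside [U] is separated from [th0] by a half plane with rational threshold. The
    opposite open half planes cover the complement of [U], and compactness keeps finitely many of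
    them. *)
Let basic_nbhs (U : set (dual R A)) th0 : open U -> U th0 ->
  exists s, basic s th0 /\ basic s `<=` U.
Proof.
move=> oU Uth0.
have cC : compact (~` U).
  by apply: (subclosed_compact _ (@dual_compact R k A)) => //; exact: open_closedC.
move: cC; rewrite compact_cover => /(_ code [set c | half c th0]
  (fun c => [set th : dual R A | ratr c.2 < complex.Re (coord c.1.2 * th (e c.1.1))])).
case=> [c _|th nU|s sD sU]; first exact: half_open.
  have [c [c0 cth]] : exists c : code,
      half c th0 /\ complex.Re (coord c.1.2 * (th : dual R A) (e c.1.1)) > ratr c.2.
    by apply: separation => E; apply: nU; rewrite E.
  by exists c.
exists s; split=> [c cs|th Hth]; first exact: set_mem (sD _ cs).
apply: contrapT => /sU[c /= cs].
by rewrite ltNge; move/negP; apply; apply/ltW/Hth.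
Qed.

(** Since the codes are countable, every open set is a countable union of finite intersections of
    half planes. Hence the pi-system [trig_limit] generates the Borel sets, and agreement on it is
    enough. *)
Lemma fourier_unique (P Q : probability D R) :
  (forall a, \int[P]_th complex.Re ((th : dual R A) a) =
    \int[Q]_th complex.Re ((th : dual R A) a)) ->
  (forall a, \int[P]_th complex.Im ((th : dual R A) a) =
    \int[Q]_th complex.Im ((th : dual R A) a)) ->
  forall B, measurable B -> P B = Q B.
Proof.
move=> PQRe PQIm.
apply: (@measure_unique _ _ D (@trig_limit R k A) (fun=> setT)).
- apply/seteqP; split.
    apply: smallest_sub; first exact: smallest_sigma_algebra.
    move=> U oU.
    (* Both defaults, for a basic set not inside [U] and for an integer that codes nothing, are
       [set0], so every term of the union is a subset of [U]. *)
    pose V s : set D := if `[< basic s `<=` U >] then basic s else set0.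
    pose W n : set D := oapp V set0 (choice.unpickle n).
    have Vin s : <<s @trig_limit R k A >> (V s).
      rewrite /V; case: asboolP => _; last exact: sigma_algebra0.
      by apply: sub_sigma_algebra; exact: basic_trig_limit.
    have Win n : <<s @trig_limit R k A >> (W n).
      rewrite /W; case: (choice.unpickle n : option (seq code)) => [s|]; first exact: Vin.
      exact: sigma_algebra0.
    rewrite (_ : U = \bigcup_n W n).
      exact: (@sigma_algebra_bigcup _ setT (@trig_limit R k A)).
    apply/seteqP; split=> [th Uth|th [n _]].
      have [s [sth sU]] := basic_nbhs oU Uth.
      by exists (choice.pickle s) => //; rewrite /W choice.pickleK /= /V asboolT.
    rewrite /W; case: (choice.unpickle n : option (seq code)) => //= s.
    by rewrite /V; case: asboolP => // + sth; exact.
  apply: smallest_sub; last by move=> B [].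
  exact: sigma_algebra_measurable.
- by move=> B C; exact: trig_limitI.
- by move=> _; exact: trig_limitT.
- by apply/seteqP; split => // x _; exists 0%N.
- by move=> B; exact: trig_limit_eq.
- by move=> n; rewrite (le_lt_trans (probability_le1 _ _))// ltry.
Qed.

End FourierUniqueness.

(** * Ultrafilter limits of means *)

Section UltraMean.
Variables (R : realType) (d : measure_display) (T : measurableType d).
Variables (I : Type) (U : set_system I).
Hypothesis UU : UltraFilter U.

(** The image ultrafilter clusters at a point of a compact segment, and an ultrafilter converges to
    each of its cluster points. *)
Lemma ultra_bounded_cvg (u : I -> R) (C : R) : (forall i, `|u i| <= C) ->
  cvg (u i @[i --> U]).
Proof.
move=> uC.
have [|l [_ cl]] := @segment_compact R (- C) C (u @ U) _.
  have : \forall i \near U, `[- C, C]%classic (u i).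
    by apply: nearW => i; rewrite /= in_itv /= -ler_norml.
  by [].
apply/cvg_ex; exists l => V Vl.
have [//|UnV] := in_ultra_setVsetC (u @^-1` V) UU.
have [x [/= + Vx]] := cl (~` V) V UnV Vl.
by [].
Qed.

Variable m : I -> (T -> R) -> R.
Hypothesis mean_m : forall i, is_mean (m i).

Lemma mean_bounded J f C : is_mean (J : (T -> R) -> R) -> bounded_mfun f ->
  (forall x, `|f x| <= C) -> `|J f| <= C.
Proof.
move=> mJ bf fC; rewrite ler_norml.
have bc c : bounded_mfun (fun _ : T => c) by exact: bounded_mfun_cst.
by apply/andP; split; [rewrite -[leLHS](mean_cst mJ)|rewrite -[leRHS](mean_cst mJ)];
  apply: (mean_le mJ) => // x; have := fC x; rewrite ler_norml => /andP[].
Qed.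

Lemma ultra_mean_cvg f : bounded_mfun f ->
  m i f @[i --> U] --> lim (m i f @[i --> U]).
Proof.
move=> bf; have [_ [C fC]] := bf.
by apply: (@ultra_bounded_cvg _ C) => i; exact: mean_bounded.
Qed.

(** For bounded measurable [f] the values [m i f] stay in a fixed segment, so one ultrafilter gives
    limits for all such [f] at once. For other [f] the [lim] may be a junk value, about which
    [is_mean] claims nothing. *)
Lemma ultra_mean : is_mean (fun f => lim (m i f @[i --> U])).
Proof.
have PU : ProperFilter U := @ultra_proper _ _ UU.
split=> [f g bf bg fg|f g bf bg|c f bf|].
- have c1 := ultra_mean_cvg bf; have c2 := ultra_mean_cvg bg.
  rewrite -subr_ge0; apply: (@closed_cvg _ _ U PU (fun i => m i g - m i f) (fun y : R => 0 <= y) _ _ _ (cvgB c2 c1)).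
    exact: closed_ge.
  by apply: nearW => i; rewrite /= subr_ge0; exact: (mean_le (mean_m i)).
- apply/cvg_lim => //.
  rewrite [X in X @ _ --> _](_ : _ = (fun i => m i f + m i g)).
    by apply: cvgD; exact: ultra_mean_cvg.
  by apply/funext => i; exact: (meanD (mean_m i)).
- apply/cvg_lim => //.
  rewrite [X in X @ _ --> _](_ : _ = (fun i => c * m i f)).
    by apply: cvgM; [exact: cvg_cst|exact: ultra_mean_cvg].
  by apply/funext => i; exact: (meanZ (mean_m i)).
- apply/cvg_lim => //.
  rewrite [X in X @ _ --> _](_ : _ = (fun=> 1)); first exact: cvg_cst.
  by apply/funext => i; exact: (mean1 (mean_m i)).
Qed.

End UltraMean.

(** * Finite measures on the torus approximating a positive definite function *)

Section Matches.
Variables n N : nat.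

(* [|matches p q| / N^n] is the fraction of the Fejer-like average that survives in the moment [x^p * conj x^q]. *)
Definition matches (p q : 'I_n -> nat) : {set {ffun 'I_n -> 'I_N} * {ffun 'I_n -> 'I_N}} :=
  finset (fun st : {ffun 'I_n -> 'I_N} * {ffun 'I_n -> 'I_N} =>
    [forall i, st.2 i + p i == st.1 i + q i]%N).

(** A matching pair is determined by its first component. *)
Lemma card_matches_le (p q : 'I_n -> nat) : (#|matches p q| <= N ^ n)%N.
Proof.
have -> : (N ^ n)%N = #|{ffun 'I_n -> 'I_N}| by rewrite card_ffun !card_ord.
rewrite -(card_in_imset (f := fst)); first exact: max_card.
move=> [s t] [s' t']; rewrite !finset.in_set /= => /forallP st /forallP st' ss'.
rewrite -{}ss' in st' *; congr pair; apply/ffunP => i; apply/val_inj => /=.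
by apply/eqP; rewrite -(eqn_add2r (p i)) (eqP (st i)) (eqP (st' i)).
Qed.

(** Each [u] with entries below [N - 2] yields the matching pair [(u + p, u + q)]; the bound 2 on
    the exponents keeps its entries below [N]. *)
Lemma card_matches_ge (p q : 'I_n -> nat) :
  (forall i, p i <= 2)%N -> (forall i, q i <= 2)%N ->
  ((N - 2) ^ n <= #|matches p q|)%N.
Proof.
move=> p2 q2.
have -> : ((N - 2) ^ n)%N = #|{ffun 'I_n -> 'I_(N - 2)}| by rewrite card_ffun !card_ord.
have lt2 (k : 'I_(N - 2)) r : (r <= 2)%N -> (k + r < N)%N.
  by move=> r2; have := ltn_ord k; lia.
pose h (u : {ffun 'I_n -> 'I_(N - 2)}) :=
  ([ffun i => Ordinal (lt2 (u i) _ (p2 i))] : {ffun 'I_n -> 'I_N},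
   [ffun i => Ordinal (lt2 (u i) _ (q2 i))] : {ffun 'I_n -> 'I_N}).
rewrite -(card_imset (f := h)).
  apply: subset_leq_card; apply/fintype.subsetP => _ /imsetP[u _ ->].
  by rewrite finset.in_set /=; apply/forallP => i; rewrite !ffunE /= addnAC.
move=> u v [/ffunP huv _]; apply/ffunP => i; apply/val_inj => /=.
have := huv i; rewrite !ffunE => /(congr1 val) /= /eqP.
by rewrite eqn_add2r => /eqP.
Qed.

End Matches.

(** Arbitrary finite index types let the definition apply directly to the function spaces
    [{ffun 'I_n -> 'I_N}] summed over in [weight]. *)
Definition positive_definite_additive (C : numClosedFieldType) (V : zmodType) (phi : V -> C) :=
  forall (F : finType) (E : F -> V) (v : F -> C),
    0 <= \sum_s \sum_t (v s)^* * phi (E s - E t) * v t.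

Section FiniteApproximation.
Variables (C : numClosedFieldType) (V : zmodType) (phi : V -> C).
Hypothesis phi_pd : positive_definite_additive phi.
Variables (n N : nat) (e : 'I_n -> V) (w : C).
Notation M := N.+2.
Hypothesis w_prim : M.-primitive_root w.

Definition monomial (j : {ffun 'I_n -> 'I_M}) (p : 'I_n -> nat) : C :=
  \prod_i w ^+ (j i * p i).

Definition lincomb (p : 'I_n -> nat) : V := \sum_i e i *+ p i.

(* The density at the grid point [(w^(j i))_i] of the measure whose [(p, q)] moment is [phi (Ep - Eq)] up to a Fejer factor; it is nonnegative as an average of [phi] over pairs. *)
Definition weight (j : {ffun 'I_n -> 'I_M}) : C := (M ^ n * N ^ n)%:R^-1 *
  \sum_(s : {ffun 'I_n -> 'I_N}) \sum_(t : {ffun 'I_n -> 'I_N})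
    (monomial j (fun i => s i))^* * phi (lincomb (fun i => s i) - lincomb (fun i => t i)) *
    monomial j (fun i => t i).

Lemma weight_ge0 j : 0 <= weight j.
Proof. by rewrite mulr_ge0 ?invr_ge0 ?ler0n//; exact: phi_pd. Qed.

Lemma w_norm : `|w| = 1.
Proof.
have /(congr1 Num.norm) := prim_expr_order w_prim.
by rewrite normrX normr1 => /eqP; rewrite pexpr_eq1// => /eqP.
Qed.

Lemma root_orthogonality u v : (u < M)%N -> (v < M)%N ->
  \sum_(j < M) w ^+ (j * u) * (w ^+ (j * v))^* = M%:R * (u == v)%:R.
Proof.
move=> uM vM; set z := w ^+ u * (w ^+ v)^*.
have wv : w ^+ v * (w ^+ v)^* = 1 by rewrite -normCK normrX w_norm !expr1n.
have -> : \sum_(j < M) w ^+ (j * u) * (w ^+ (j * v))^* = \sum_(j < M) z ^+ j.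
  apply: eq_bigr => j _.
  by rewrite /z exprMn -rmorphXn /= -!exprM [(u * j)%N]mulnC [(v * j)%N]mulnC.
have [uv|uv] := eqVneq u v.
  rewrite mulr1 /z uv wv; under eq_bigr do rewrite expr1n.
  by rewrite sumr_const card_ord.
rewrite mulr0; apply/eqP.
have z1 : z != 1.
  apply: contra uv => /eqP z1.
  have : w ^+ u = z * w ^+ v by rewrite /z -mulrA [_^* * _]mulrC wv mulr1.
  by rewrite z1 mul1r => /eqP; rewrite (eq_prim_root_expr w_prim) !modn_small.
have zM : z ^+ M = 1.
  rewrite /z exprMn -rmorphXn /= -!exprM ![(_ * M)%N]mulnC !exprM.
  by rewrite (prim_expr_order w_prim) !expr1n rmorph1 mulr1.
by have := subrX1 z M; rewrite zM subrr => /esym/eqP; rewrite mulf_eq0 subr_eq0 (negbTE z1).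
Qed.

Lemma monomial_orthogonality (u v : 'I_n -> nat) :
  (forall i, u i < M)%N -> (forall i, v i < M)%N ->
  \sum_j monomial j u * (monomial j v)^* = (M ^ n)%:R * [forall i, u i == v i]%:R.
Proof.
move=> uM vM.
transitivity (\sum_(j : {ffun 'I_n -> 'I_M}) \prod_i (w ^+ (j i * u i) * (w ^+ (j i * v i))^*)).
  by apply: eq_bigr => j _; rewrite /monomial rmorph_prod -big_split.
rewrite -(bigA_distr_bigA (fun i (k : 'I_M) => w ^+ (k * u i) * (w ^+ (k * v i))^*)).
under eq_bigr do rewrite root_orthogonality//.
rewrite big_split /= prodr_const card_ord natrX; congr (_ * _).
have [/forallP uv|] := boolP [forall i, u i == v i].
  by rewrite big1// => i _; rewrite uv.
rewrite negb_forall => /existsP[i uvi].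
by rewrite (bigD1 i)//= (negbTE uvi) mul0r.
Qed.

Lemma monomialD j (p q : 'I_n -> nat) :
  monomial j (fun i => p i + q i)%N = monomial j p * monomial j q.
Proof.
by rewrite /monomial -big_split; apply: eq_bigr => i _; rewrite mulnDr exprD.
Qed.

Lemma lincombD (p q : 'I_n -> nat) :
  lincomb (fun i => p i + q i)%N = lincomb p + lincomb q.
Proof.
by rewrite /lincomb -big_split; apply: eq_bigr => i _; rewrite mulrnDr.
Qed.

(** The entries of [s] and [t] are below [N] and those of [p] and [q] at most 2, so all exponents
    stay below [M = N + 2] and orthogonality on the grid of [M]-th roots of unity involves no
    reduction modulo [M]. Exactly the pairs with [t + p = s + q] survive, and for them
    [s - t = p - q], so [phi] takes the same value on all of them. *)
Lemma weight_moment (p q : 'I_n -> nat) : (0 < N)%N ->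
  (forall i, p i <= 2)%N -> (forall i, q i <= 2)%N ->
  \sum_j weight j * (monomial j p * (monomial j q)^*) =
  phi (lincomb p - lincomb q) * (#|matches N p q|%:R / (N ^ n)%:R).
Proof.
move=> N0 p2 q2.
transitivity ((M ^ n * N ^ n)%:R^-1 *
   \sum_(s : {ffun 'I_n -> 'I_N}) \sum_(t : {ffun 'I_n -> 'I_N})
      phi (lincomb (fun i => s i) - lincomb (fun i => t i)) *
      \sum_j monomial j (fun i => t i + p i)%N * (monomial j (fun i => s i + q i)%N)^*).
  transitivity (\sum_j (M ^ n * N ^ n)%:R^-1 *
    (\sum_(s : {ffun 'I_n -> 'I_N}) \sum_(t : {ffun 'I_n -> 'I_N})
      phi (lincomb (fun i => s i) - lincomb (fun i => t i)) *
      (monomial j (fun i => t i + p i)%N * (monomial j (fun i => s i + q i)%N)^*))).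
    apply: eq_bigr => j _; rewrite /weight -mulrA; congr (_ * _).
    rewrite mulr_suml; apply: eq_bigr => s _; rewrite mulr_suml; apply: eq_bigr => t _.
    by rewrite !monomialD rmorphM /=; ring.
  rewrite -mulr_sumr exchange_big; congr (_ * _); apply: eq_bigr => s _.
  by rewrite exchange_big; apply: eq_bigr => t _; rewrite mulr_sumr.
rewrite -sum1_card natr_sum pair_bigA /=.
rewrite natrM invfM mulrAC [in RHS]mulrA; congr (_ * _).
rewrite [in RHS]big_mkcond /= !mulr_sumr; apply: eq_bigr => -[s t] _ /=.
rewrite monomial_orthogonality; last 2 first.
- by move=> i; rewrite -addn2 -addSn leq_add.
- by move=> i; rewrite -addn2 -addSn leq_add.
rewrite finset.in_set /=; case: ifPn => [/forallP st|_]; last by rewrite !mulr0.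
rewrite mulr1 mulr1 mulrCA mulVf ?mulr1; last by rewrite pnatr_eq0 expn_eq0.
congr phi; apply/eqP; rewrite subr_eq addrAC eq_sym subr_eq -!lincombD eq_sym; apply/eqP.
rewrite /lincomb; apply: eq_bigr => i _; congr (_ *+ _).
by rewrite [RHS]addnC (eqP (st i)).
Qed.

End FiniteApproximation.

(** In characteristic 0 the polynomial [X^n - 1] is separable, so it has [n] distinct roots, and a
    primitive root is found among [n] distinct [n]-th roots of unity. *)
Lemma prim_root_exists (C : numClosedFieldType) n : (0 < n)%N ->
  exists w : C, n.-primitive_root w.
Proof.
move=> n_gt0; have [r Dp] := closed_field_poly_normal ('X^n - 1 : {poly C}).
rewrite (monicP _) ?monicXnsubC // scale1r in Dp.
have rn1 : all n.-unity_root r by apply/allP=> z; rewrite -root_prod_XsubC -Dp.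
have sz_r : (n < (size r).+1)%N.
  by rewrite -(size_prod_XsubC r id) -Dp size_XnsubC.
have [|z] := hasP (cyclic.has_prim_root n_gt0 rn1 _ sz_r); last by exists z.
rewrite -separable.separable_prod_XsubC -Dp.
by rewrite cyclotomic.separable_Xn_sub_1// pnatr_eq0 -lt0n.
Qed.

Section Deltas.
Variables (C : numClosedFieldType) (V : zmodType) (n N : nat) (e : 'I_n -> V) (w : C).

Lemma monomial_delta (j : {ffun 'I_n -> 'I_N.+2}) (i : 'I_n) :
  monomial w j (fun t => (t == i)%N : nat) = w ^+ j i.
Proof.
rewrite /monomial (bigD1 i)//= eqxx muln1 big1 ?mulr1// => t /negbTE ti.
by rewrite ti muln0 expr0.
Qed.

Lemma lincomb_delta (i : 'I_n) : lincomb e (fun t => (t == i)%N : nat) = e i.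
Proof.
rewrite /lincomb (bigD1 i)//= eqxx mulr1n big1 ?addr0// => t /negbTE ti.
by rewrite ti mulr0n.
Qed.

Lemma monomial0 (j : {ffun 'I_n -> 'I_N.+2}) : monomial w j (fun=> 0%N) = 1.
Proof. by rewrite /monomial big1// => i _; rewrite muln0. Qed.

Lemma lincomb0 : lincomb e (fun=> 0%N) = 0.
Proof. by rewrite /lincomb big1. Qed.

Lemma card_matches0 : #|@matches n N (fun=> 0%N) (fun=> 0%N)| = (N ^ n)%N.
Proof.
apply/eqP; rewrite eqn_leq card_matches_le /=.
have -> : (N ^ n)%N = #|{ffun 'I_n -> 'I_N}| by rewrite card_ffun !card_ord.
rewrite -(card_imset (f := fun s : {ffun 'I_n -> 'I_N} => (s, s))); last by move=> s t [].
apply: subset_leq_card; apply/fintype.subsetP => _ /imsetP[s _ ->].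
by rewrite finset.in_set /=; apply/forallP.
Qed.

End Deltas.

(* [N = 2 (n+1)^2] gives [(1 - 2/N)^n >= 1 - 1/(n+1)]. *)
Definition box_size (n : nat) : nat := (n.+1 ^ 2).*2.

Lemma box_size_gt1 n : (1 < box_size n)%N.
Proof. by have := expn_gt0 n.+1 2; rewrite /box_size /=; lia. Qed.

Lemma box_ratio (R : realFieldType) n (p q : 'I_n -> nat) :
  (forall i, p i <= 2)%N -> (forall i, q i <= 2)%N ->
  1 - n.+1%:R^-1 <= (#|matches (box_size n) p q|%:R / (box_size n ^ n)%:R : R) <= 1.
Proof.
move=> p2 q2; set N := box_size n.
have N2 : (2 <= N)%N := box_size_gt1 n.
have N0 : (0 : R) < (N ^ n)%:R by rewrite ltr0n expn_gt0 (leq_trans _ N2).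
rewrite ler_pdivrMr// mul1r ler_nat card_matches_le andbT.
apply: (@le_trans _ _ (((N - 2) ^ n)%:R / (N ^ n)%:R)); last first.
  by rewrite ler_pM2r ?invr_gt0// ler_nat card_matches_ge.
have NR : (N%:R : R) != 0 by rewrite pnatr_eq0 -lt0n (leq_trans _ N2).
rewrite !natrX -expr_div_n natrB// mulrBl divff//.
apply: le_trans (bernoulli_ge _ _); last first.
  by rewrite ler_pdivrMr ?mul1r ?ler_nat// ltr0n (leq_trans _ N2).
rewrite lerD2l lerN2 mulrA ler_pdivrMr ?ltr0n ?(leq_trans _ N2)//.
rewrite [leRHS]mulrC ler_pdivlMr ?ltr0n//.
rewrite -natrM -natrM ler_nat /N /box_size; nia.
Qed.

Lemma complexReM_ge0 (R : realType) (a b : R[i]) : 0 <= a ->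
  complex.Re (a * b) = complex.Re a * complex.Re b.
Proof. by move=> a0; rewrite complexReM (ger0_Im a0) mul0r subr0. Qed.

Lemma complexImM_ge0 (R : realType) (a b : R[i]) : 0 <= a ->
  complex.Im (a * b) = complex.Re a * complex.Im b.
Proof. by move=> a0; rewrite complexImM (ger0_Im a0) mul0r addr0. Qed.

Section FiniteMean.
Variables (R : realType) (V : zmodType) (phi : V -> R[i]).
Hypotheses (phi_pd : positive_definite_additive phi) (phi0 : phi 0 = 1).
Variable e : nat -> V.
Variable n : nat.
Notation N := (box_size n).

Let w : R[i] := projT1 (cid (@prim_root_exists R[i] N.+2 isT)).
Let w_prim : N.+2.-primitive_root w := projT2 (cid (@prim_root_exists R[i] N.+2 isT)).
Let en (i : 'I_n) := e i.
Let wt (j : {ffun 'I_n -> 'I_N.+2}) := weight phi en w j.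

(** Coordinates from [n] on are frozen at 1; a given coordinate runs over the roots of unity as soon
    as [n] exceeds it. *)
Definition sample_fun (j : {ffun 'I_n -> 'I_N.+2}) (i : nat) : R[i] :=
  if insub i is Some i' then w ^+ j i' else 1.

Lemma sample_torus j : @torus_set R nat (sample_fun j).
Proof.
move=> i; rewrite /sample_fun; case: insubP => [i' _ _|_]; last exact: normr1.
by rewrite normrX (w_norm w_prim) expr1n.
Qed.

Definition sample j : torus R nat := exist _ (sample_fun j) (mem_set (sample_torus j)).

Lemma sampleE j (i : 'I_n) : torus_fun (sample j) i = w ^+ j i.
Proof. by rewrite /torus_fun set_valE /= /sample_fun valK. Qed.

Let wt_ge0 j : 0 <= wt j. Proof. exact: weight_ge0. Qed.

Definition finite_mean (f : torus R nat -> R) : R :=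
  \sum_j complex.Re (wt j) * f (sample j).

Let Re_sum (I : finType) (F : I -> R[i]) :
  complex.Re (\sum_i F i) = \sum_i complex.Re (F i).
Proof. by apply: (big_morph _ (@complexReD R)). Qed.

Let Im_sum (I : finType) (F : I -> R[i]) :
  complex.Im (\sum_i F i) = \sum_i complex.Im (F i).
Proof. by apply: (big_morph _ (@complexImD R)). Qed.

Lemma finite_mean_Re (g : torus R nat -> R[i]) :
  finite_mean (fun x => complex.Re (g x)) = complex.Re (\sum_j wt j * g (sample j)).
Proof.
rewrite Re_sum; apply: eq_bigr => j _.
by rewrite (complexReM_ge0 _ (wt_ge0 j)).
Qed.

Lemma finite_mean_Im (g : torus R nat -> R[i]) :
  finite_mean (fun x => complex.Im (g x)) = complex.Im (\sum_j wt j * g (sample j)).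
Proof.
rewrite Im_sum; apply: eq_bigr => j _.
by rewrite (complexImM_ge0 _ (wt_ge0 j)).
Qed.

Let moment (p q : 'I_n -> nat) (g : torus R nat -> R[i]) :
  (forall i, p i <= 2)%N -> (forall i, q i <= 2)%N ->
  (forall j, g (sample j) = monomial w j p * (monomial w j q)^*) ->
  \sum_j wt j * g (sample j) =
  phi (lincomb en p - lincomb en q) *
    ((#|matches N p q|%:R / (N ^ n)%:R : R)%:C)%C.
Proof.
move=> p2 q2 gE.
under eq_bigr do rewrite gE.
have N0 : (0 < N)%N := ltnW (box_size_gt1 n).
rewrite (weight_moment phi en w_prim N0 p2 q2).
by congr (_ * _); rewrite rmorphM fmorphV !rmorph_nat.
Qed.

(** The total mass is the moment with all exponents 0, where the Fejer factor is exactly 1 by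
    [card_matches0]; the mean is thus normalized without rescaling. *)
Lemma finite_mean_is_mean : is_mean (finite_mean : (borel (torus R nat) -> R) -> R).
Proof.
split=> [f g _ _ fg|f g _ _|c f _|].
- by apply: ler_sum => j _; rewrite ler_wpM2l//; move: (wt_ge0 j); rewrite lecE => /andP[].
- by rewrite /finite_mean -big_split; apply: eq_bigr => j _; rewrite mulrDr.
- by rewrite /finite_mean mulr_sumr; apply: eq_bigr => j _; rewrite mulrCA.
- transitivity (complex.Re (\sum_j wt j * 1)); first exact: (finite_mean_Re (fun=> 1)).
  rewrite (@moment (fun=> 0%N) (fun=> 0%N) (fun=> 1))//; last first.
    by move=> j; rewrite monomial0 rmorph1 mulr1.
  rewrite subrr phi0 mul1r card_matches0 divff; first by [].
  by rewrite pnatr_eq0 -lt0n expn_gt0 (ltnW (box_size_gt1 n)).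
Qed.

Lemma finite_mean_eval (i : nat) : (i < n)%N ->
  exists r : R, [/\ 1 - n.+1%:R^-1 <= r <= 1,
    finite_mean (fun x => complex.Re (torus_fun x i)) = complex.Re (phi (e i)) * r &
    finite_mean (fun x => complex.Im (torus_fun x i)) = complex.Im (phi (e i)) * r].
Proof.
move=> i_n; pose i' := Ordinal i_n.
pose p (t : 'I_n) : nat := (t == i')%N; pose q (t : 'I_n) := 0%N.
have p2 t : (p t <= 2)%N by rewrite /p; case: eqP.
exists (#|matches N p q|%:R / (N ^ n)%:R); split; first exact: box_ratio.
  rewrite finite_mean_Re (@moment p q (fun x => torus_fun x i))//; last first.
    by move=> j; rewrite (sampleE j i') monomial_delta monomial0 rmorph1 mulr1.
  by rewrite lincomb_delta lincomb0 subr0 complexReM /= mulr0 subr0.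
rewrite finite_mean_Im (@moment p q (fun x => torus_fun x i))//; last first.
  by move=> j; rewrite (sampleE j i') monomial_delta monomial0 rmorph1 mulr1.
by rewrite lincomb_delta lincomb0 subr0 complexImM /= mulr0 add0r.
Qed.

(** These moments detect multiplicativity: if [e m = e i + e l], their limit is [phi 0]. The indices
    [i] and [l] may coincide, which is where the exponent 2 comes from. *)
Lemma finite_mean_eval3 (i l m : nat) : (i < n)%N -> (l < n)%N -> (m < n)%N ->
  exists r : R, 1 - n.+1%:R^-1 <= r <= 1 /\
    finite_mean (fun x => complex.Re (torus_fun x i * torus_fun x l * (torus_fun x m)^*)) =
    complex.Re (phi (e i + e l - e m)) * r.
Proof.
move=> i_n l_n m_n; pose i' := Ordinal i_n; pose l' := Ordinal l_n; pose m' := Ordinal m_n.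
pose p (t : 'I_n) : nat := ((t == i') + (t == l'))%N; pose q (t : 'I_n) : nat := (t == m')%N.
have p2 t : (p t <= 2)%N by rewrite /p; case: eqP; case: eqP.
have q2 t : (q t <= 2)%N by rewrite /q; case: eqP.
exists (#|matches N p q|%:R / (N ^ n)%:R); split; first exact: box_ratio.
rewrite finite_mean_Re
  (@moment p q (fun x => torus_fun x i * torus_fun x l * (torus_fun x m)^*))//; last first.
  move=> j; rewrite (sampleE j i') (sampleE j l') (sampleE j m').
  by rewrite monomialD !monomial_delta.
by rewrite lincombD !lincomb_delta complexReM /= mulr0 subr0.
Qed.

End FiniteMean.

Lemma cvg_ratio (R : realType) (u : nat -> R) (L : R) (n0 : nat) :
  (forall n, (n0 < n)%N -> exists r : R, 1 - n.+1%:R^-1 <= r <= 1 /\ u n = L * r) ->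
  u n @[n --> \oo] --> L.
Proof.
move=> uL.
have c0 : `|L| * harmonic n @[n --> \oo] --> (0 : R).
  by rewrite -[X in _ --> X](mulr0 `|L|); apply: cvgM; [exact: cvg_cst|exact: cvg_harmonic].
apply: (@squeeze_cvgr _ _ _ _ (fun n => L - `|L| * harmonic n) (fun n => L + `|L| * harmonic n)).
- near=> n.
  have [r [/andP[r1 r2] ->]] : exists r, 1 - n.+1%:R^-1 <= r <= 1 /\ u n = L * r.
    by apply: uL; near: n; exact: nbhs_infty_gt.
  rewrite -ler_distl -[X in _ - X]mulr1 -mulrBr normrM ler_wpM2l//.
  by rewrite ler0_norm ?subr_le0// opprB lerBlDr addrC -lerBlDr.
- by rewrite -[X in _ --> X]subr0; apply: cvgB => //; exact: cvg_cst.
- by rewrite -[X in _ --> X]addr0; apply: cvgD => //; exact: cvg_cst.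
Unshelve. all: by end_near. Qed.

(** * Bochner's theorem on the dual *)

Section AlmostEverywhere.
Variables (R : realType) (d : measure_display) (T : measurableType d) (P : probability T R).

Lemma Rintegral0_ae (g : T -> R) : bounded_mfun g -> (forall x, 0 <= g x) ->
  \int[P]_x g x = 0 -> {ae P, forall x, g x = 0}.
Proof.
move=> bg g0 ig.
have mg : measurable_fun setT (EFin \o g) by apply/measurable_EFinP; case: bg.
have E : (\int[P]_x `|(EFin \o g) x| = \int[P]_x (g x)%:E)%E.
  by apply: eq_integral => x _ /=; rewrite ger0_norm.
have : (\int[P]_x `|(EFin \o g) x| = 0)%E.
  rewrite E -(fineK (integrable_fin_num measurableT (bounded_mfun_integrable P bg))).
  by congr EFin; exact: ig.
move/(ae_eq_integral_abs P measurableT mg); apply: filterS => x /= /(_ I).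
by move=> [].
Qed.

Lemma ae_Rintegral (f g : T -> R) : measurable_fun setT f -> measurable_fun setT g ->
  {ae P, forall x, f x = g x} -> \int[P]_x f x = \int[P]_x g x.
Proof.
move=> mf mg fg; congr fine; apply: ae_eq_integral => //.
- exact/measurable_EFinP.
- exact/measurable_EFinP.
- by apply: filterS fg => x /= ->.
Qed.

End AlmostEverywhere.

Section Bochner.
Variables (R : realType) (k : fieldType) (A : nilAlgType k).
Hypothesis A_countable : countable [set: A].
Variable phi : A -> R[i].
Hypotheses (phi_pd : positive_definite_additive phi) (phi0 : phi 0 = 1).
Notation torusN := (torus R nat).

(** A surjection from [nat] with a section is enough; [A] may be finite, so no bijection is
    asked. *)
Lemma countable_coding : exists (e : nat -> A) (f : A -> nat), cancel f e.
Proof.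
have [e eP] := countable_enumeration A_countable.
by have [f fP] := choice eP; exists e, f.
Qed.

Let e : nat -> A := projT1 (cid countable_coding).
Let f : A -> nat := projT1 (cid (projT2 (cid countable_coding))).
Let fK : cancel f e := projT2 (cid (projT2 (cid countable_coding))).

(** A moment that converges along [\oo] keeps its limit along a finer ultrafilter, and the
    representing measure sees it because the moment functions are continuous on the torus. *)
Lemma torus_limit : exists P : probability (borel torusN) R,
  [/\ forall i, \int[P]_x complex.Re (torus_fun x i) = complex.Re (phi (e i)),
      forall i, \int[P]_x complex.Im (torus_fun x i) = complex.Im (phi (e i)) &
      forall i l m, e m = e i + e l ->
        \int[P]_x complex.Re (torus_fun x i * torus_fun x l * (torus_fun x m)^*) = 1].
Proof.
have [U [UU oU]] := ultraFilterLemma (F := \oo) _.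
have PU : ProperFilter U := @ultra_proper _ _ UU.
pose m n : (borel torusN -> R) -> R := finite_mean phi e n.
have mm n : is_mean (m n) by exact: finite_mean_is_mean.
have [P [_ _ PJ]] := mean_representation (@torus_hausdorff R nat) (@torus_compact R nat)
  (ultra_mean UU mm).
have lim g (L : R) : continuous (g : torusN -> R) -> m n g @[n --> \oo] --> L -> \int[P]_x g x = L.
  move=> cg gL; rewrite -PJ//; apply/cvg_lim => //.
  by move=> V /gL; exact: oU.
have cev i := (@torus_eval_continuous R nat i).
exists P; split=> [i|i|i l j eij].
- apply: lim; first by have /complex_continuousE[] := cev i.
  apply: (@cvg_ratio R _ _ i) => n i_n.
  by have [r [r1 rE _]] := finite_mean_eval phi_pd e i_n; exists r.
- apply: lim; first by have /complex_continuousE[] := cev i.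
  apply: (@cvg_ratio R _ _ i) => n i_n.
  by have [r [r1 _ rE]] := finite_mean_eval phi_pd e i_n; exists r.
- apply: lim.
    have [] // : complex_continuous (fun x : torusN => torus_fun x i * torus_fun x l * (torus_fun x j)^*).
    by apply: complex_continuousM; [apply: complex_continuousM|apply: complex_continuous_conj];
      apply/complex_continuousE/cev.
  rewrite [X in _ --> X](_ : 1 = complex.Re (phi (e i + e l - e j))); last first.
    by rewrite -eij subrr phi0.
  apply: (@cvg_ratio R _ _ (maxn i (maxn l j))) => n.
  rewrite !gtn_max => /and3P[i_n l_n j_n].
  exact: (finite_mean_eval3 phi_pd e i_n l_n j_n).
Qed.

Let reindex (x : torusN) : {ptws A -> R[i]^o} := fun a => torus_fun x (f a).

Let reindex_continuous : continuous reindex.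
Proof.
move=> x; apply: ptws_cvg => [|a]; last exact: torus_eval_continuous.
exact: (@fmap_filter torusN _ reindex (nbhs x) (nbhs_filter x)).
Qed.

Let good : set torusN := reindex @^-1` @character_set R k A.

(* [retract] is junk off [good], which has full measure. *)
Let retract (x : borel torusN) : borel_dual R A :=
  if pselect (good x) is left gx then exist _ (reindex x) (mem_set gx)
  else trivial_dual R A.

Let retractE x : good x -> forall a, (retract x : dual R A) a = torus_fun x (f a).
Proof. by move=> gx a; rewrite /retract; case: pselect. Qed.

(** [good] is closed, the restriction of [retract] to it is continuous, and off it [retract] is
    constant. *)
Let retract_measurable : measurable_fun setT retract.
Proof.
apply: (@measurability _ _ (borel torusN) (borel_dual R A) setT retract (@open (dual R A))) => //.
move=> _ [_ [V oV <-] <-]; rewrite setTI.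
rewrite (_ : _ @^-1` _ = (good `&` reindex @^-1` V) `|`
    (~` good `&` [set _ : torusN | V (set_val (trivial_dual R A : @character_set R k A))])).
  have mgood : measurable (good : set (borel torusN)).
    apply: closed_borel; apply: closed_comp => [x _|]; first exact: reindex_continuous.
    exact: character_set_closed.
  apply: measurableU.
    apply: measurableI => //; apply: sub_sigma_algebra.
    by move/continuousP : reindex_continuous; exact.
  apply: measurableI; first exact: measurableC.
  have [tV|tV] := pselect (V (set_val (trivial_dual R A : @character_set R k A))).
    by rewrite (_ : [set _ | _] = setT)//; apply/seteqP; split.
  by rewrite (_ : [set _ | _] = set0)//; apply/seteqP; split.
apply/seteqP; split=> x; rewrite /preimage /= /retract; case: pselect => gx.
- by left.
- by right.
- by case=> [[]|[]].
- by case=> [[]|[]].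
Qed.

Lemma bochner : exists Q : probability (borel_dual R A) R,
  [/\ regular_measure Q, null_off_borel Q,
      forall a, \int[Q]_th complex.Re ((th : dual R A) a) = complex.Re (phi a) &
      forall a, \int[Q]_th complex.Im ((th : dual R A) a) = complex.Im (phi a)].
Proof.
have [P [PRe PIm Pmul]] := torus_limit.
(* [Re z <= |z| = 1] has mean 1 for [z = x_a x_b conj(x_(a+b))], so [z = 1] almost everywhere. *)
have aegood : {ae P, forall x, good x}.
  have : {ae P, forall x : borel torusN, forall i l m, e m = e i + e l ->
      complex.Re (torus_fun x i * torus_fun x l * (torus_fun x m)^*) = 1}.
    apply: ae_foralln => i; apply: ae_foralln => l; apply: ae_foralln => m.
    have [em|nem] := pselect (e m = e i + e l); last by apply: aeW => x /nem.
    pose g (x : borel torusN) : R := complex.Re (torus_fun x i * torus_fun x l * (torus_fun x m)^*).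
    have bg : bounded_mfun g.
      apply: (@continuous_bounded_mfun R torusN); first exact: torus_compact.
      have [] // : complex_continuous (fun x : torusN => torus_fun x i * torus_fun x l * (torus_fun x m)^*).
      by apply: complex_continuousM; [apply: complex_continuousM|apply: complex_continuous_conj];
        apply/complex_continuousE/torus_eval_continuous.
    have b1 := @bounded_mfun_cst R _ (borel torusN) 1.
    have := @Rintegral0_ae _ _ _ P (fun x => 1 - g x) (bounded_mfunB b1 bg).
    rewrite (meanB (mean_Rintegral P))// (mean_cst (mean_Rintegral P)) Pmul// subrr.
    move=> /(_ _ erefl) H.
    have : {ae P, forall x, 1 - g x = 0}.
      apply: H => x; rewrite subr_ge0 (le_trans (ler_norm _))//.
      by apply: Re_le_normC; rewrite !normrM norm_conjC !torus_norm !mulr1.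
    by apply: filterS => x /eqP; rewrite subr_eq0 => /eqP g1 _; rewrite -/(g x) -g1.
  apply: filterS => x Hx; split=> [a b|a]; last exact: torus_norm.
  have := Hx (f a) (f b) (f (a + b)); rewrite !fK => /(_ erefl).
  rewrite /reindex; set z := _ * _ * _ => z1.
  have nz : `|z| = 1 by rewrite /z !normrM norm_conjC !torus_norm !mulr1.
  have {z1} : z = 1.
    apply: complex_eqP => //=.
    have := add_Re2_Im2 z; rewrite nz z1 expr1n => /(congr1 (@complex.Re R)) /=.
    by rewrite expr1n -[RHS]addr0 => /addrI /eqP; rewrite sqrf_eq0 => /eqP.
  rewrite /z => /(congr1 (fun y => y * torus_fun x (f (a + b)))).
  by rewrite mul1r -mulrA [_^* * _]mulrC -normCK torus_norm expr1n mulr1.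
(* The push-forward of [P] along [retract] is used only as a mean, so that [mean_representation]
   supplies regularity and the value 0 off the Borel sets. *)
pose J (g : borel_dual R A -> R) : R := \int[P]_x g (retract x).
have bcomp (g : borel_dual R A -> R) : bounded_mfun g -> bounded_mfun (fun x => g (retract x)).
  move=> [mg [C gC]]; split; last by exists C => x; exact: gC.
  exact: (measurableT_comp mg retract_measurable).
have mJ : is_mean J.
  have mP := mean_Rintegral P.
  split=> [g h bg bh gh|g h bg bh|c g bg|].
  - by apply: (mean_le mP) => [||x]; [exact: bcomp|exact: bcomp|exact: gh].
  - by rewrite /J (meanD mP)//; exact: bcomp.
  - by rewrite /J (meanZ mP)//; exact: bcomp.
  - by rewrite /J (mean1 mP).
have [Q [regQ nullQ QJ]] := mean_representation (@dual_hausdorff R k A) (@dual_compact R k A) mJ.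
exists Q; split => // a.
  rewrite -(QJ (fun th : dual R A => complex.Re (th a))); last exact: dual_Re_continuous.
  rewrite /J -[in RHS](fK a) -PRe; apply: ae_Rintegral.
  - by have [] := bcomp _ (@bounded_mfun_Re R k A a).
  - apply: (@continuous_borel R torusN).
    by have /complex_continuousE[] := @torus_eval_continuous R nat (f a).
  - by apply: negligibleS aegood => x; apply: contra_not => gx; congr (complex.Re _); exact: retractE.
rewrite -(QJ (fun th : dual R A => complex.Im (th a))); last exact: dual_Im_continuous.
rewrite /J -[in RHS](fK a) -PIm; apply: ae_Rintegral.
- by have [] := bcomp _ (@bounded_mfun_Im R k A a).
- apply: (@continuous_borel R torusN).
  by have /complex_continuousE[] := @torus_eval_continuous R nat (f a).
- by apply: negligibleS aegood => x; apply: contra_not => gx; congr (complex.Im _); exact: retractE.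
Qed.

End Bochner.

(** Besides the set function the packed structure holds only proofs, which are identified field by
    field by proof irrelevance. *)
Lemma probability_eq (R : realType) d (T : measurableType d) (P Q : probability T R) :
  (forall B, P B = Q B) -> P = Q.
Proof.
move=> PQ; have {PQ} : (P : set T -> \bar R) = Q by apply/funext.
case: P Q => [P Pc] [Q Qc] /= PQ; move: Pc Qc; rewrite {}PQ => Pc Qc.
congr Probability.Pack.
case: Pc Qc => [c1 m1 a1 b1 d1 e1 f1] [c2 m2 a2 b2 d2 e2 f2].
have c12 : c1 = c2.
  case: c1 {m1 a1 b1 d1 e1 f1} => c d1; case: c2 {m2 a2 b2 d2 e2 f2} => c' d1'.
  by congr isContent.Axioms_; exact: Prop_irrelevance.
subst c2; congr Probability.Class.
- by case: m1 m2 => [u] [v]; congr Content_isMeasure.Axioms_; exact: Prop_irrelevance.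
- by case: a1 a2 => [u] [v]; congr isSFinite.Axioms_; exact: Prop_irrelevance.
- by case: b1 b2 => [u] [v]; congr isSigmaFinite.Axioms_; exact: Prop_irrelevance.
- by case: d1 d2 => [u] [v]; congr isFinite.Axioms_; exact: Prop_irrelevance.
- by case: e1 e2 => [u] [v]; congr isSubProbability.Axioms_; exact: Prop_irrelevance.
- by case: f1 f2 => [u] [v]; congr isProbability.Axioms_; exact: Prop_irrelevance.
Qed.

Lemma eq_measure_Rintegral (R : realType) d (T : measurableType d) (P Q : probability T R) (f : T -> R) :
  (forall B, measurable B -> P B = Q B) -> \int[P]_x f x = \int[Q]_x f x.
Proof. by move=> PQ; congr fine; apply: eq_measure_integral => B mB _; exact: PQ. Qed.

(** * The two-sided action and the Fourier transform of a probability *)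

Section Action.
Variables (k : fieldType) (A : nilAlgType k).
Implicit Types (g h : algebra_group A) (a b : A).

Lemma bimulM g g' a h h' : bimul (g * g')%g a (h' * h)%g = bimul g (bimul g' a h') h.
Proof.
rewrite /bimul /=.
set x := subone g; set x' := subone g'; set y := subone h; set y' := subone h'.
have lactM b : b + amul (x + x' + amul x x') b = (b + amul x' b) + amul x (b + amul x' b).
  by rewrite !amulDl amulDr amulA !addrA; congr (_ + _); rewrite addrAC.
have ractM b : b + amul b (y' + y + amul y' y) = (b + amul b y') + amul (b + amul b y') y.
  by rewrite !amulDr amulDl amulA !addrA.
have comm b : (b + amul b y') + amul x (b + amul b y') = (b + amul x b) + amul (b + amul x b) y'.
  by rewrite amulDr amulDl amulA addrACA.
by rewrite lactM ractM comm.
Qed.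

Lemma bimul1 a : bimul 1%g a 1%g = a.
Proof. by rewrite /bimul /= amul0l addr0 amul0r addr0. Qed.

Lemma subone_mulV g h : subone (g * h^-1)%g = bimul 1%g (subone g - subone h) h^-1%g.
Proof.
have q := quasi_inverser (subone h).
rewrite /bimul /= amul0l addr0 amulDl amulNl.
(* Here [z] is the quasi-inverse of [b], and [u], [v] stand for the products [a z], [b z]; the
   relation [z = - b - v] eliminates [z]. *)
have E (a b z u v : A) : b + z + v = 0 -> a + z + u = a - b + (u - v).
  move=> bzv; have -> : z = - b - v.
    by apply/eqP; rewrite -subr_eq0 opprD !opprK addrA [z + _]addrC bzv.
  by rewrite !addrA [LHS]addrAC.
exact: E.
Qed.

Lemma subone_inv g : subone (g^-1)%g = bimul 1%g (- subone g) g^-1%g.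
Proof. by have := subone_mulV 1%g g; rewrite mul1g sub0r. Qed.

End Action.

Section FourierTransform.
Variables (R : realType) (k : fieldType) (A : nilAlgType k).
Hypothesis A_countable : countable [set: A].
Notation D := (borel_dual R A).
Implicit Types (P Q : probability D R) (a b : A).

Definition fourier P a : R[i] :=
  ((\int[P]_th complex.Re ((th : dual R A) a)) +i*
   (\int[P]_th complex.Im ((th : dual R A) a)))%C.

Lemma fourier_inj P Q : fourier P =1 fourier Q -> forall B, measurable B -> P B = Q B.
Proof.
by move=> PQ; apply: (fourier_unique A_countable) => a; have [] := PQ a.
Qed.

Lemma fourier_lincomb P (I : finType) (c : I -> R[i]) (a : I -> A) :
  \sum_i c i * fourier P (a i) =
  ((\int[P]_th complex.Re (\sum_i c i * (th : dual R A) (a i))) +i*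
   (\int[P]_th complex.Im (\sum_i c i * (th : dual R A) (a i))))%C.
Proof.
have mP := mean_Rintegral P.
have bRe b : bounded_mfun (fun th : D => complex.Re ((th : dual R A) b)) by exact: bounded_mfun_Re.
have bIm b : bounded_mfun (fun th : D => complex.Im ((th : dual R A) b)) by exact: bounded_mfun_Im.
apply: complex_eqP => /=.
  rewrite (big_morph _ (@complexReD R) (erefl (complex.Re 0))).
  under eq_Rintegral do rewrite (big_morph _ (@complexReD R) (erefl (complex.Re 0))).
  rewrite (mean_sum mP); last by move=> i _; exact: bounded_mfun_term.
  apply: eq_bigr => i _; rewrite complexReM /=.
  under [RHS]eq_Rintegral do rewrite complexReM.
  by rewrite (meanB mP) ?(meanZ mP)//; exact: bounded_mfunZ.
rewrite (big_morph _ (@complexImD R) (erefl (complex.Im 0))).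
under eq_Rintegral do rewrite (big_morph _ (@complexImD R) (erefl (complex.Im 0))).
have bt (c' : R[i]) b : bounded_mfun (fun th : D => complex.Im (c' * (th : dual R A) b)).
  under eq_fun do rewrite complexImM.
  by apply: bounded_mfunD; exact: bounded_mfunZ.
rewrite (mean_sum mP); last by move=> i _; exact: bt.
apply: eq_bigr => i _; rewrite complexImM /=.
under [RHS]eq_Rintegral do rewrite complexImM.
by rewrite (meanD mP) ?(meanZ mP)//; exact: bounded_mfunZ.
Qed.

Lemma fourier0 P : fourier P 0 = 1.
Proof.
have mP := mean_Rintegral P.
apply: complex_eqP => /=.
  by under eq_Rintegral do rewrite dual0 /=; exact: (mean_cst mP 1).
by under eq_Rintegral do rewrite dual0 /=; exact: (mean_cst mP 0).
Qed.

Lemma fourierN P a : fourier P (- a) = (fourier P a)^*.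
Proof.
apply: complex_eqP => /=.
  by apply: eq_Rintegral => th _; rewrite dualN; case: (dual_fun th a).
transitivity (\int[P]_th (- complex.Im ((th : dual R A) a))).
  by apply: eq_Rintegral => th _; rewrite dualN; case: (dual_fun th a).
by rewrite (meanN (mean_Rintegral P))//; exact: bounded_mfun_Im.
Qed.

(** The form is the integral of the squared modulus of the sum of [v i * conj (th (a i))]. *)
Lemma fourier_pd P (I : finType) (a : I -> A) (v : I -> R[i]) :
  0 <= \sum_i \sum_j (v i)^* * fourier P (a i - a j) * v j.
Proof.
have -> : \sum_i \sum_j (v i)^* * fourier P (a i - a j) * v j =
    \sum_(p : I * I) ((v p.1)^* * v p.2) * fourier P (a p.1 - a p.2).
  by rewrite pair_bigA; apply: eq_bigr => -[i j] _ /=; rewrite mulrAC.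
rewrite fourier_lincomb.
have E th : \sum_(p : I * I) ((v p.1)^* * v p.2) * (th : dual R A) (a p.1 - a p.2) =
    `|\sum_i v i * ((th : dual R A) (a i))^*| ^+ 2.
  rewrite normCK rmorph_sum mulrC mulr_suml.
  under [RHS]eq_bigr do rewrite mulr_sumr.
  rewrite pair_bigA; apply: eq_bigr => -[i j] _ /=.
  by rewrite dualD dualN rmorphM /= conjCK; ring.
rewrite lecE /=; apply/andP; split.
  apply/eqP; rewrite -[RHS](mean_cst (mean_Rintegral P) 0).
  by apply: eq_Rintegral => th _; rewrite E ger0_Im// exprn_ge0.
apply: Rintegral_ge0 => th _; rewrite E.
by have : 0 <= `|\sum_i v i * ((th : dual R A) (a i))^*| ^+ 2 by [rewrite exprn_ge0|];
  rewrite lecE => /andP[].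
Qed.

Lemma dual_act_measurable gam : measurable_fun [set: D] (@dual_act R k A gam : D -> D).
Proof.
apply: (@measurability _ _ D D setT _ (@open (dual R A))) => //.
move=> _ [V oV <-]; rewrite setTI; apply: sub_sigma_algebra.
by move: (@dual_act_continuous R k A gam) => /continuousP; exact.
Qed.

Definition act_mfun gam : {mfun D >-> D} := mfun_Sub (mem_set (dual_act_measurable gam)).

Lemma act_distributionE P gam B :
  distribution P (act_mfun gam) B = P (dual_act gam @^-1` B).
Proof. by []. Qed.

Lemma Rintegral_distribution P gam (f : D -> R) : bounded_mfun f ->
  \int[distribution P (act_mfun gam)]_th f th = \int[P]_th f (dual_act gam th).
Proof.
move=> bf; congr fine; rewrite integral_distribution//.
  by apply/measurable_EFinP; case: bf.
apply: (bounded_mfun_integrable P (f := fun th => f (dual_act gam th))).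
case: bf => mf [C fC]; split; last by exists C => x; exact: fC.
exact: (measurableT_comp mf (dual_act_measurable gam)).
Qed.

Lemma fourier_distribution P gam a :
  fourier (distribution P (act_mfun gam)) a = fourier P (bimul (gam.1^-1)%g a gam.2).
Proof.
apply: complex_eqP => /=.
  by rewrite (Rintegral_distribution P gam (@bounded_mfun_Re R k A a)).
by rewrite (Rintegral_distribution P gam (@bounded_mfun_Im R k A a)).
Qed.

Lemma invariantP P : invariant_measure P <->
  forall g a h, fourier P (bimul g a h) = fourier P a.
Proof.
split=> [invP g a h|H gam B mB].
  have := fourier_distribution P (g^-1, h)%g a; rewrite /= invgK => <-.
  apply: complex_eqP => /=; apply: eq_measure_Rintegral => B mB;
    exact: invP.
rewrite -act_distributionE; apply: fourier_inj => // a.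
by rewrite fourier_distribution H.
Qed.

End FourierTransform.

Lemma hermitian_formE (R : realType) (m : nat) (M : 'M[R[i]]_m) (v : 'cV[R[i]]_m) :
  ((map_mx Num.conj v)^T *m M *m v) 0 0 =
  \sum_i \sum_j (v i 0)^* * M i j * v j 0.
Proof.
rewrite mxE exchange_big; apply: eq_bigr => j _; rewrite mxE mulr_suml.
by apply: eq_bigr => i _; rewrite !mxE.
Qed.

(** * Supercharacters and invariant measures *)

Section SupercharacterMeasure.
Variables (R : realType) (k : fieldType) (A : nilAlgType k).
Hypothesis A_countable : countable [set: A].
Notation D := (borel_dual R A).
Notation G := (algebra_group A).
Implicit Types (P Q : probability D R) (a b : A) (g h : G).
Implicit Types (xi eta : SCh R A) (mu nu : inv_measure R A).

Lemma SCh_bimul xi g a h : xi (OnePlus (bimul g a h)) = xi (OnePlus a).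
Proof.
have [_ _ xiC] : SCh_set xi := set_valP xi.
apply: (xiC a); first by exists g, h.
by exists 1%g, 1%g; rewrite bimul1.
Qed.

Lemma SCh_mulV xi g h : xi (g * h^-1)%g = xi (OnePlus (subone g - subone h)).
Proof.
have -> : (g * h^-1)%g = OnePlus (subone (g * h^-1)%g) by case: (g * h^-1)%g.
by rewrite subone_mulV SCh_bimul.
Qed.

Lemma SCh_positive_definite_additive xi :
  positive_definite_additive (fun a => xi (OnePlus a)).
Proof.
move=> F E v.
have [[_ xi_pd] _ _] : SCh_set xi := set_valP xi.
have /= := xi_pd #|F| (fun i => OnePlus (E (enum_val i))) (\col_i v (enum_val i)).
rewrite hermitian_formE; congr (0 <= _).
rewrite (reindex (@enum_val F predT)) /=; last exact/onW_bij/enum_val_bij.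
apply: eq_bigr => i _.
rewrite (reindex (@enum_val F predT)) /=; last exact/onW_bij/enum_val_bij.
by apply: eq_bigr => j _; rewrite !mxE SCh_mulV.
Qed.

Lemma fourier_SCh P : invariant_measure P -> SCh_set (fun g => fourier P (subone g)).
Proof.
move=> /(invariantP A_countable) invP; split; first split.
- by move=> g; rewrite subone_inv invP fourierN.
- move=> m g v; rewrite hermitian_formE.
  have := fourier_pd P (fun i => subone (g i)) (fun i => v i 0).
  congr (0 <= _); apply: eq_bigr => i _; apply: eq_bigr => j _.
  by rewrite mxE subone_mulV invP.
- exact: fourier0.
- by move=> a x y [g [h ->]] [g' [h' ->]]; rewrite !invP.
Qed.

Lemma cintegral_eval mu g :
  cintegral mu (fun th => th (subone g)) = fourier (measure_of mu) (subone g).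
Proof. by []. Qed.

Lemma inv_measureP mu : [/\ regular_measure (measure_of mu),
  invariant_measure (measure_of mu) & null_off_borel (measure_of mu)].
Proof. by have : inv_measure_set (measure_of mu) := set_valP mu. Qed.

Lemma inv_measure_inj mu nu :
  fourier (measure_of mu) =1 fourier (measure_of nu) -> mu = nu.
Proof.
move=> fmunu; apply: val_inj; apply: probability_eq => B.
have [_ _ mu0] := inv_measureP mu; have [_ _ nu0] := inv_measureP nu.
have [mB|nmB] := pselect (measurable B); first exact: fourier_inj.
by rewrite -/(measure_of mu) -/(measure_of nu) mu0// nu0.
Qed.

Lemma SCh_measure_exists xi : exists mu : inv_measure R A,
  forall a, fourier (measure_of mu) a = xi (OnePlus a).
Proof.
have [_ xi1 _] : SCh_set xi := set_valP xi.
have [Q [rQ nQ QRe QIm]] :=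
  bochner A_countable (SCh_positive_definite_additive xi) xi1.
have fQ a : fourier Q a = xi (OnePlus a) by apply: complex_eqP; [exact: QRe|exact: QIm].
have iQ : invariant_measure Q.
  by apply/(invariantP A_countable) => g a h; rewrite !fQ SCh_bimul.
have sQ : inv_measure_set Q by [].
by exists (exist _ Q (mem_set sQ)).
Qed.

Definition SCh_measure xi : inv_measure R A := projT1 (cid (SCh_measure_exists xi)).

Lemma fourier_SCh_measure xi a : fourier (measure_of (SCh_measure xi)) a = xi (OnePlus a).
Proof. by rewrite /SCh_measure; case: cid. Qed.

(** Regularity is not asked of [P], so that this applies directly to the conditional measures in
    [indecomposable_ergodic]. *)
Definition SCh_of_probability P (iP : invariant_measure P) : SCh R A :=
  exist (fun phi => phi \in @SCh_set R k A) _ (mem_set (fourier_SCh iP)).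

Definition measure_SCh mu : SCh R A :=
  SCh_of_probability (let: And3 _ imu _ := inv_measureP mu in imu).

Lemma measure_SChE mu g : measure_SCh mu g = fourier (measure_of mu) (subone g).
Proof. by []. Qed.

Lemma SCh_ext xi eta : xi =1 eta -> xi = eta.
Proof. by move=> xe; apply: val_inj; apply/funext. Qed.

Lemma SCh_measureK : cancel SCh_measure measure_SCh.
Proof.
move=> xi; apply: SCh_ext => g.
by rewrite measure_SChE fourier_SCh_measure; case: g.
Qed.

Lemma measure_SChK : cancel measure_SCh SCh_measure.
Proof. by move=> mu; apply: inv_measure_inj => a; rewrite fourier_SCh_measure. Qed.

(** The measure of [xi] is recognized from coefficients alone. This serves for mixtures and for
    ultrafilter limits, whose invariance is then never checked directly. *)
Lemma SCh_measure_eq xi P :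
  (forall a, fourier P a = xi (OnePlus a)) ->
  forall B, measurable B -> measure_of (SCh_measure xi) B = P B.
Proof.
by move=> fP; apply: fourier_inj => // a; rewrite fourier_SCh_measure fP.
Qed.

Lemma SCh_measure_unique xi : exists! mu : inv_measure R A,
  forall g, xi g = cintegral mu (fun th => th (subone g)).
Proof.
exists (SCh_measure xi); split=> [g|mu xiE].
  by rewrite cintegral_eval fourier_SCh_measure; case: g.
by apply: inv_measure_inj => a; rewrite fourier_SCh_measure xiE.
Qed.

End SupercharacterMeasure.

(** * Continuity of the correspondence in both directions *)

Lemma cvg_ultra (T : Type) (V : topologicalType) (F : set_system T) (f : T -> V) (l : V) :
  Filter F ->
  (forall U, UltraFilter U -> F `<=` U -> f x @[x --> U] --> l) -> f x @[x --> F] --> l.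
Proof.
move=> FF H W Wl; apply: contrapT => nFW.
have PF : ProperFilter (within (~` (f @^-1` W)) F).
  apply: Build_ProperFilter_ex => B /= FB; apply: contrapT => B0; apply: nFW.
  suff : F (f @^-1` W) by [].
  have : F [set x | ~ W (f x) -> B x] by [].
  apply: filterS => x /= xB; apply: contrapT => nW.
  by apply: B0; exists x; exact: xB.
have [U [UU FU]] := ultraFilterLemma PF.
have PU : ProperFilter U := @ultra_proper _ _ UU.
have UW : U (f @^-1` W).
  apply: (H U UU) => // B FB; apply: FU.
  by apply: filterS FB => x Bx _.
have UnW : U (~` (f @^-1` W)) by apply: FU; apply: nearW => x.
have [x [/= Wx nWx]] := filter_ex (filterI UW UnW).
exact: nWx.
Qed.

Section Continuity.
Variables (R : realType) (k : fieldType) (A : nilAlgType k).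
Hypothesis A_countable : countable [set: A].
Notation D := (borel_dual R A).
Notation G := (algebra_group A).
Notation M := (SCh_measure A_countable).

Lemma SCh_eval_continuous (g : G) : continuous (fun xi : SCh R A => xi g : R[i]^o).
Proof.
move=> xi; apply: (@continuous_comp _ _ _ (set_val : SCh R A -> {ptws G -> R[i]^o}) (fun phi => phi g)).
  exact: set_val_continuous.
exact: eval_continuous.
Qed.

Lemma weak_star_eval_continuous (f : continuousType (dual R A) R[i]^o) :
  continuous (fun mu : inv_measure R A => weak_star_eval mu f : R[i]^o).
Proof.
move=> mu; apply: (@continuous_comp _ _ _ (@weak_star_eval R k A) (fun phi => phi f)).
  exact: initial_continuous.
exact: eval_continuous.
Qed.

(** Evaluation of a supercharacter at [g] is the weak* evaluation at the continuous function sending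
    [th] to [th (g - 1)]. *)
Lemma measure_SCh_continuous : continuous (measure_SCh A_countable : inv_measure R A -> SCh R A).
Proof.
apply: continuous_comp_initial => mu; apply: ptws_cvg => [|g].
  exact: (@fmap_filter (inv_measure R A) _ (set_val \o measure_SCh A_countable) (nbhs mu) (nbhs_filter mu)).
exact: (@weak_star_eval_continuous (mkcts (@dual_eval_continuous R k A (subone g))) mu).
Qed.

(** Testing on ultrafilters, along which all bounded integrals converge, replaces compactness of the
    set of invariant measures. The limit mean has a representing probability with the coefficients
    of [xi], which identifies it as the measure of [xi]. *)
Lemma integral_SCh_measure_cvg (f : dual R A -> R) (xi : SCh R A) : continuous f ->
  \int[measure_of (M eta)]_th f th @[eta --> nbhs xi] --> \int[measure_of (M xi)]_th f th.
Proof.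
move=> cf; apply: cvg_ultra => U UU xiU.
have PU : ProperFilter U := @ultra_proper _ _ UU.
pose m (eta : SCh R A) (h : D -> R) := \int[measure_of (M eta)]_th h th.
have mm eta : is_mean (m eta) by exact: mean_Rintegral.
have [P [_ _ JP]] := mean_representation (@dual_hausdorff R k A) (@dual_compact R k A) (ultra_mean UU mm).
have bf h : continuous (h : dual R A -> R) -> bounded_mfun (h : D -> R).
  exact: (continuous_bounded_mfun (@dual_compact R k A)).
have lim_int h : continuous (h : dual R A -> R) -> m eta h @[eta --> U] --> \int[P]_th h th.
  by move=> ch; rewrite -JP//; exact: (ultra_mean_cvg UU mm (bf h ch)).
have fP a : fourier P a = xi (OnePlus a).
  have ev : (fun eta : SCh R A => eta (OnePlus a) : R[i]^o) @ U --> (xi (OnePlus a) : R[i]^o).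
    by move=> V Vxi; apply: xiU; exact: (SCh_eval_continuous Vxi).
  have [reE imE] := (iffLR (cvg_complexP _ _ _) ev).
  have uniq_lim (u : SCh R A -> R) (x y : R) : u @ U --> x -> u @ U --> y -> x = y.
    by move=> ux uy; rewrite -(cvg_lim _ ux)//; exact: cvg_lim.
  apply: complex_eqP => /=.
    apply: (uniq_lim (fun eta => m eta (fun th => complex.Re ((th : dual R A) a)))).
  exact: (lim_int _ (@dual_Re_continuous R k A a)).
    apply: cvg_trans reE; apply: near_eq_cvg; apply: nearW => eta.
    by rewrite -(fourier_SCh_measure A_countable).
  apply: (uniq_lim (fun eta => m eta (fun th => complex.Im ((th : dual R A) a)))).
  exact: (lim_int _ (@dual_Im_continuous R k A a)).
  apply: cvg_trans imE; apply: near_eq_cvg; apply: nearW => eta.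
  by rewrite -(fourier_SCh_measure A_countable).
rewrite (@eq_measure_Rintegral R _ D _ _ f (SCh_measure_eq A_countable fP)).
exact: lim_int.
Qed.

Lemma SCh_measure_continuous : continuous (M : SCh R A -> inv_measure R A).
Proof.
apply: continuous_comp_initial => xi; apply: ptws_cvg => [|f];
  have FF := @fmap_filter (SCh R A) _ (@weak_star_eval R k A \o M) (nbhs xi) (nbhs_filter xi) => //.
have /complex_continuousE[cRe cIm] := @cts_fun _ _ f.
apply/cvg_complexP; split.
  exact: (@integral_SCh_measure_cvg _ xi cRe).
exact: (@integral_SCh_measure_cvg _ xi cIm).
Qed.

End Continuity.

(** * Mixtures, Hahn decompositions and ergodicity *)

Section Mixtures.
Context (R : realType) d (T : measurableType d).
Implicit Types (P Q S : probability T R) (t : R) (B C N : set T).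

Lemma mnormalizeE (mu : {measure set T -> \bar R}) P B :
  mu setT != 0%E -> mu setT != +oo%E ->
  (mnormalize mu P : probability T R) B = (mu B * (fine (mu setT))^-1%:E)%E.
Proof. by rewrite /= /mnormalize => /negbTE-> /negbTE->. Qed.

Definition mixture t P Q S := forall B, measurable B ->
  S B = (t%:E * P B + (1 - t)%:E * Q B)%E.

Lemma mixtureC t P Q S : mixture t P Q S -> mixture (1 - t) Q P S.
Proof. by move=> m B mB; rewrite m// subKr addeC. Qed.

Lemma mixture_exists t P Q : 0 <= t <= 1 -> exists S, mixture t P Q S.
Proof.
move=> /andP[t0 t1]; have s0 : 0 <= 1 - t by rewrite subr_ge0.
pose mu : {measure set T -> \bar R} := measure_add (mscale (NngNum t0) P) (mscale (NngNum s0) Q).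
have muE B : mu B = (t%:E * P B + (1 - t)%:E * Q B)%E 
    by exact: (measure_addE (mscale (NngNum t0) P) (mscale (NngNum s0) Q)).
have muT : mu setT = 1%E.
  by rewrite muE !probability_setT !mule1 -EFinD addrC subrK.
(* [mu] already has mass 1; [mnormalize] packages it as a probability. *)
exists (mnormalize mu P) => B _.
by rewrite mnormalizeE muT ?onee_eq0//= invr1 mule1; exact: muE.
Qed.

Lemma Rintegral_mixture t P Q S (f : T -> R) : 0 <= t <= 1 -> mixture t P Q S ->
  bounded_mfun f -> \int[S]_x f x = t * \int[P]_x f x + (1 - t) * \int[Q]_x f x.
Proof.
move=> /andP[t0 t1] m bf; have s0 : 0 <= 1 - t by rewrite subr_ge0.
(* Adding a bound of [|f|] makes [f] nonnegative, and the integral of a nonnegative function is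
   additive in the measure. *)
wlog f0 : f bf / forall x, 0 <= f x.
  have [_ [C fC]] := bf => H.
  have bC : bounded_mfun (fun _ : T => C) by exact: bounded_mfun_cst.
  have := H (fun x => f x + C) (bounded_mfunD bf bC).
  rewrite !(meanD (mean_Rintegral _) bf bC) !(mean_cst (mean_Rintegral _)) => /(_ _).
  move=> H'; apply: (addIr (C : R)); rewrite H'; first by ring.
  by move=> x; have := fC x; rewrite ler_norml => /andP[? _]; rewrite -lerBlDr sub0r.
have mf : measurable_fun setT (EFin \o f) by apply/measurable_EFinP; case: bf.
have int_fin P' : (\int[P']_x (f x)%:E)%E \is a fin_num.
  by apply: integrable_fin_num => //; exact: bounded_mfun_integrable.
rewrite /Rintegral (@eq_measure_integral _ T R setT
    (measure_add (mscale (NngNum t0) P) (mscale (NngNum s0) Q))); last first.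
  move=> B mB _; apply: (eq_trans (m B mB)); apply/esym.
  exact: (measure_addE (mscale (NngNum t0) P) (mscale (NngNum s0) Q)).
have f0' (x : T) : setT x -> (0 <= (f x)%:E)%E by rewrite lee_fin.
rewrite ge0_integral_measure_add// !ge0_integral_mscale//.
by rewrite /= -(fineK (int_fin P)) -(fineK (int_fin Q)).
Qed.

(** Both total masses are 1, so the inequality on the complement is the reverse inequality on the
    set. *)
Lemma probability_le_eq P Q : (forall B, measurable B -> (P B <= Q B)%E) ->
  forall B, measurable B -> P B = Q B.
Proof.
move=> PQ B mB; apply/eqP; rewrite eq_le PQ//=.
have := PQ _ (measurableC mB); rewrite !probability_setC//.
rewrite -(fineK (fin_num_measure P B mB)) -(fineK (fin_num_measure Q B mB)).
by rewrite !lee_fin lerD2l lerN2.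
Qed.

(** [P] is carried by [C], so [P B] is the mass of the part of [B] in [C], which is at most its
    [Q]-mass and hence at most [Q B]. *)
Lemma probability_le_on_eq P Q C : measurable C -> P (~` C) = 0%E ->
  (forall B, measurable B -> B `<=` C -> (P B <= Q B)%E) ->
  forall B, measurable B -> P B = Q B.
Proof.
move=> mC PC0 PQ; apply: probability_le_eq => B mB.
have mBC : measurable (B `&` C) by exact: measurableI.
rewrite (measureDI P mB mC) (subset_measure0 _ _ _ PC0) ?add0e//.
- apply: le_trans (PQ _ mBC _) _ => //.
  by apply: le_measure; [exact/mem_set|exact/mem_set|exact: subIsetl].
- exact: measurableD.
- exact: measurableC.
Qed.

(** The relation is stated as a product to avoid division in the extended reals. *)
Lemma conditional_probability P B : measurable B -> P B != 0%E ->
  exists Q, forall C, measurable C -> P (C `&` B) = (P B * Q C)%E.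
Proof.
move=> mB PB0; exists (mnormalize (mrestr P mB) P) => C mC.
have fB := fin_num_measure P B mB.
have rT : (mrestr P mB : {measure set T -> \bar R}) setT = P B by rewrite /= /mrestr setTI.
have Poo : P B != +oo%E by move: fB; rewrite fin_numE => /andP[].
rewrite mnormalizeE rT// /= /mrestr muleC -muleA -{2}(fineK fB) -EFinM mulVf ?mule1//.
by rewrite fine_eq0.
Qed.

End Mixtures.

Section Hahn.
Context (R : realType) d (T : measurableType d).
Variables (P Q : probability T R).

Definition probability_diff : {charge set T -> \bar R} :=
  cadd (charge_of_finite_measure P) (copp (charge_of_finite_measure Q)).

Lemma probability_diff_le0 B : measurable B ->
  (probability_diff B <= 0)%E = (P B <= Q B)%E.
Proof.
move=> mB; rewrite /= /cadd /= /copp /=.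
exact: sube_le0.
Qed.

Lemma probability_diff_ge0 B : measurable B ->
  (0 <= probability_diff B)%E = (Q B <= P B)%E.
Proof.
move=> mB; rewrite /= /cadd /= /copp /=.
by rewrite sube_ge0// fin_num_measure.
Qed.

End Hahn.

Section DualAction.
Variables (R : realType) (k : fieldType) (A : nilAlgType k).
Implicit Types (th : dual R A) (gam : algebra_group A * algebra_group A).

Lemma dual_actM gam del th :
  dual_act gam (dual_act del th) = dual_act ((gam.1 * del.1)%g, (gam.2 * del.2)%g) th.
Proof.
apply: val_inj; apply/funext => a /=.
by rewrite /dual_act /dual_fun /= invgM bimulM.
Qed.

Lemma dual_act1 th : dual_act (1%g, 1%g) th = th.
Proof.
apply: val_inj; apply/funext => a /=.
by rewrite invg1 bimul1.
Qed.

Definition inv_pair gam := (gam.1^-1%g, gam.2^-1%g).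

Lemma dual_actK gam : cancel (@dual_act R k A gam) (dual_act (inv_pair gam)).
Proof. by move=> th; rewrite dual_actM /= !mulVg dual_act1. Qed.

Lemma dual_actVK gam : cancel (dual_act (inv_pair gam)) (@dual_act R k A gam).
Proof. by move=> th; rewrite dual_actM /= !mulgV dual_act1. Qed.

Lemma dual_act_image gam (B : set (dual R A)) :
  dual_act gam @` B = dual_act (inv_pair gam) @^-1` B.
Proof.
apply/seteqP; split=> [_ [th Bth <-]|th Bth] /=; first by rewrite dual_actK.
by exists (dual_act (inv_pair gam) th) => //; rewrite dual_actVK.
Qed.

Lemma dual_act_preimage gam (B : set (dual R A)) :
  (forall gam, dual_act gam @` B = B) -> dual_act gam @^-1` B = B.
Proof.
move=> invB; rewrite -[in RHS](invB (inv_pair gam)) dual_act_image.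
by rewrite /inv_pair /= !invgK -surjective_pairing.
Qed.

End DualAction.

Section Ergodicity.
Variables (R : realType) (k : fieldType) (A : nilAlgType k).
Hypothesis A_countable : countable [set: A].
Notation D := (borel_dual R A).
Notation M := (SCh_measure A_countable).
Implicit Types (P Q S : probability D R) (t : R) (gam : algebra_group A * algebra_group A).

Lemma measurable_dual_act gam (B : set D) : measurable B ->
  measurable (dual_act gam @^-1` B : set D).
Proof. by move=> mB; rewrite -[X in measurable X]setTI; exact: dual_act_measurable. Qed.

Lemma fourier_mixture t P Q S a : 0 <= t <= 1 -> mixture t P Q S ->
  fourier S a = t%:C%C * fourier P a + (1 - t)%:C%C * fourier Q a.
Proof.
move=> t01 m; apply: complex_eqP.
  rewrite complexReD !complexReM /= !mul0r !subr0.
  exact: (Rintegral_mixture t01 m (@bounded_mfun_Re R k A a)).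
rewrite complexImD !complexImM /= !mul0r !addr0.
exact: (Rintegral_mixture t01 m (@bounded_mfun_Im R k A a)).
Qed.

Lemma SCh_measure_affine : affine (M : SCh R A -> inv_measure R A).
Proof.
move=> t xi eta B mB.
have t01 : 0 <= (t%:num : R) <= 1 by rewrite ge0 le1.
have [S mS] := mixture_exists (measure_of (M xi)) (measure_of (M eta)) t01.
rewrite -mS//; apply: SCh_measure_eq => // a.
by rewrite (fourier_mixture a t01 mS) !fourier_SCh_measure.
Qed.

Lemma negative_set_preimage P Q gam (N : set D) :
  invariant_measure P -> invariant_measure Q ->
  negative_set (probability_diff P Q) N ->
  negative_set (probability_diff P Q) (dual_act gam @^-1` N).
Proof.
move=> iP iQ [mN negN]; split; first exact: measurable_dual_act.
move=> C mC CN; rewrite probability_diff_le0//.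
have mC' : measurable (dual_act (inv_pair gam) @^-1` C : set D) by exact: measurable_dual_act.
rewrite -(iP (inv_pair gam))// -(iQ (inv_pair gam))// -probability_diff_le0//.
by apply: negN => // th /CN /=; rewrite dual_actVK.
Qed.

(** The acting group is countable, so the union of all translates of a negative set is a countable
    union and is again measurable and negative. It contains the original negative set, hence its
    complement lies in the positive one. *)
Lemma invariant_hahn P Q : invariant_measure P -> invariant_measure Q ->
  exists N : set D, [/\ measurable N, forall gam, dual_act gam @` N = N,
    forall B, measurable B -> B `<=` N -> (P B <= Q B)%E &
    forall B, measurable B -> B `<=` ~` N -> (Q B <= P B)%E].
Proof.
move=> iP iQ.
have [Y [N [[mY posY] negN YN _]]] := Hahn_decomposition (probability_diff P Q).
have [e eP] := countable_enumeration A_countable.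
pose N' : set D := \bigcup_i \bigcup_j dual_act (OnePlus (e i), OnePlus (e j)) @^-1` N.
have N'E th : N' th <-> exists gam, N (dual_act gam th).
  split=> [[i _ [j _ Nth]]|[[[a] [b]] Nth]].
    by exists (OnePlus (e i), OnePlus (e j)).
  have [i ei] := eP a; have [j ej] := eP b.
  by exists i => //; exists j => //; rewrite ei ej.
have [mN' negN'] : negative_set (probability_diff P Q) N'.
  do 2!apply: bigcup_negative_set => ?; exact: negative_set_preimage.
exists N'; split=> // [gam|B mB BN'|B mB BN'].
- rewrite dual_act_image; apply/seteqP; split=> th /= /N'E[del].
    by rewrite dual_actM => ?; apply/N'E; eexists; eassumption.
  move=> Nth; apply/N'E; exists (del.1 * gam.1, del.2 * gam.2)%g.
  by rewrite dual_actM /= -!mulgA !mulgV !mulg1 -surjective_pairing.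
- by rewrite -probability_diff_le0//; exact: negN'.
- rewrite -probability_diff_ge0//; apply: posY => // th /BN' nN'th.
  have : [set: D] th by [].
  rewrite -YN => -[//|Nth]; exfalso; apply/nN'th/N'E; exists (1%g, 1%g).
  by rewrite dual_act1.
Qed.

(** As [t > 0], [P] vanishes on null sets of [mu]. If [mu N = 0], then [mu] is carried by the
    complement of [N], where it is at most [P]; if [mu N = 1], then [P] is carried by [N], where it
    is at most [mu]. In both cases domination between probabilities forces equality. *)
Lemma ergodic_mixture (mu : inv_measure R A) P Q t : ergodic mu -> 0 < t < 1 ->
  invariant_measure P -> mixture t P Q (measure_of mu) ->
  forall B, measurable B -> P B = measure_of mu B.
Proof.
move=> emu /andP[t0 t1] iP m.
have [_ imu _] := inv_measureP mu.
have null B : measurable B -> measure_of mu B = 0%E -> P B = 0%E.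
  move=> mB; rewrite m// => /eqP.
  rewrite padde_eq0 ?mule_ge0 ?measure_ge0 ?lee_fin ?subr_ge0 ?(ltW t0) ?(ltW t1)//.
  by rewrite mule_eq0 eqe gt_eqF//= => /andP[/eqP].
have [N [mN iN PN NP]] := invariant_hahn iP imu.
have mNC := measurableC mN.
case: (emu N mN iN) => muN B mB.
  by apply/esym; apply: (probability_le_on_eq mNC) => //; rewrite setCK.
apply: (probability_le_on_eq mN) => //; apply: null => //.
by rewrite probability_setC// muN subee.
Qed.

Lemma ergodic_indecomposable (xi : SCh R A) : ergodic (M xi) -> indecomposable xi.
Proof.
move=> erg t xi1 xi2 t01 xiE.
have m1 : mixture (t%:num : R) (measure_of (M xi1)) (measure_of (M xi2)) (measure_of (M xi)).
  by move=> B mB; rewrite [in LHS]xiE; exact: SCh_measure_affine.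
have eq_xi s eta eta' : 0 < s < 1 ->
    mixture s (measure_of (M eta)) (measure_of (M eta')) (measure_of (M xi)) -> eta = xi.
  move=> s01 m; have [_ ieta _] := inv_measureP (M eta).
  apply: SCh_ext => -[a]; rewrite -!(fourier_SCh_measure A_countable).
  have e := ergodic_mixture erg s01 ieta m.
  by apply: complex_eqP => /=; exact: eq_measure_Rintegral.
split; first exact: eq_xi m1.
apply: (eq_xi (1 - t%:num) xi2 xi1); last exact: mixtureC.
by move: t01 => /andP[? ?]; rewrite subr_gt0 ltrBlDr ltrDl; apply/andP.
Qed.

Lemma indecomposable_ergodic (xi : SCh R A) : indecomposable xi -> ergodic (M xi).
Proof.
move=> indec B mB invB; set mu := measure_of (M xi).
have [_ imu _] : [/\ _, invariant_measure mu & _] := inv_measureP (M xi).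
have [muB0|muB0] := eqVneq (mu B) 0%E; [by left|right].
apply: contrapT => /eqP muB1.
have mBC := measurableC mB.
have muBC0 : mu (~` B) != 0%E.
  rewrite probability_setC// -(fineK (fin_num_measure mu B mB)) -EFinB eqe subr_eq0.
  by rewrite eq_sym -eqe fineK ?fin_num_measure.
have [P PE] := conditional_probability mB muB0.
have [Q QE] := conditional_probability mBC muBC0.
have inv_cond (C : set D) (S : probability D R) : measurable C -> mu C != 0%E ->
    (forall gam, dual_act gam @^-1` C = C) ->
    (forall E, measurable E -> mu (E `&` C) = (mu C * S E)%E) -> invariant_measure S.
  move=> mC muC0 iC SE gam E mE.
  have mgE := measurable_dual_act gam mE.
  have fC := fin_num_measure mu C mC.
  have C0 : fine (mu C) != 0 by rewrite fine_eq0.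
  have : (mu C * S (dual_act gam @^-1` E) = mu C * S E)%E.
    rewrite -SE// -SE// -[in LHS](iC gam) -preimage_setI; apply: imu.
    exact: measurableI.
  move=> /(congr1 (fun x => (fine (mu C))^-1%:E * x)%E).
  by rewrite !muleA -(fineK fC) -EFinM /= mulVf// !mul1e.
have iB gam := dual_act_preimage gam invB.
have iP : invariant_measure P by exact: (inv_cond B).
have iQ : invariant_measure Q.
  by apply: (inv_cond (~` B)) => // gam; exact: (congr1 setC (iB gam)).
have fB := fin_num_measure mu B mB.
pose t : R := fine (mu B).
have tE : mu B = t%:E by rewrite /t fineK.
have t0 : 0 <= t by rewrite fine_ge0.
have t1 : t <= 1 by rewrite -lee_fin -tE probability_le1.
have m : mixture t P Q mu.
  move=> E mE; transitivity (mu (E `&` ~` B) + mu (E `&` B))%E.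
    exact: (measureDI mu mE mB).
  rewrite QE// PE// addeC.
  by rewrite probability_setC// tE EFinB.
have t01 : 0 < (Itv01 t0 t1)%:num < 1.
  move: muB0 muB1; rewrite /= tE !eqe => ? ?.
  by rewrite !lt_neqAle eq_sym t0 t1 !andbT; apply/andP.
have xiE : xi = SCh_conv (Itv01 t0 t1) (SCh_of_probability A_countable iP)
    (SCh_of_probability A_countable iQ).
  apply: SCh_ext => -[a]; rewrite -(fourier_SCh_measure A_countable).
  by rewrite (fourier_mixture a _ m) ?t0.
have [xiP _] := indec _ _ _ t01 xiE.
(* As [P] is [mu] conditioned on [B], its defining relation at [B] itself now reads [t = t * t], so
   [t = 1], contrary to [muB1]. *)
have PB : P B = mu B.
  apply: (fourier_inj A_countable) => // a.
  by rewrite fourier_SCh_measure -[in RHS]xiP.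
have := PE B mB; rewrite setIid PB tE -EFinM => -[tt].
move: muB1; rewrite tE => /eqP; apply.
congr EFin; apply: (mulfI (x := t)); first by move: t01 => /andP[/gt_eqF->].
by rewrite mulr1.
Qed.

End Ergodicity.

Theorem theorem2p5 (R : realType) (k : fieldType) (A : nilAlgType k)
    (k_countable : countable [set: k]) (A_countable : countable [set: A]) :
  (forall xi : SCh R A, exists! mu : inv_measure R A,
     forall g : algebra_group A,
       xi g = cintegral mu (fun th => th (subone g))) /\
  (exists (M : SCh R A -> inv_measure R A) (X : inv_measure R A -> SCh R A),
     (forall (xi : SCh R A) (g : algebra_group A),
        xi g = cintegral (M xi) (fun th => th (subone g))) /\
     (forall (mu : inv_measure R A) (g : algebra_group A),
        X mu g = cintegral mu (fun th => th (subone g))) /\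
     homeomorphism M X /\
     affine M /\
     set_bij [set xi | indecomposable xi] [set mu | ergodic mu] M).
Proof.
split; first exact: SCh_measure_unique.
have MK := @SCh_measureK R k A A_countable.
have XK := @measure_SChK R k A A_countable.
exists (SCh_measure A_countable), (measure_SCh A_countable); split.
  by move=> xi g; rewrite cintegral_eval fourier_SCh_measure; case: g.
split; first by [].
split.
  by split=> //; [exact: SCh_measure_continuous|exact: measure_SCh_continuous].
split; first exact: SCh_measure_affine.
split.
- by move=> xi; exact: indecomposable_ergodic.
- by move=> xi eta _ _; exact: (can_inj MK).
- move=> mu erg; exists (measure_SCh A_countable mu); last exact: XK.
  by apply: (ergodic_indecomposable (A_countable := A_countable)); rewrite XK.
Qed.
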